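(* There exist absolute constants $c, C > 0$ such that the following holds. Let $0 < t < m$ be integers, let $n \ge c\, m^3\log^2 m$, let $M$ be an $m\times n$ random $t$-sparse matrix, and let $Y$ be a binomial random variable with $m$ trials and success probability $1/2$. Put $\delta_n := \sqrt{(m/n)\log n}$. If $n$ is even, then $$\left|\Pr[\operatorname{disc}(M) = 0] - 2^{-m+1}\right| \le C\delta_n, \qquad \left|\Pr[\operatorname{disc}(M) = 1] - (1 - 2^{-m+1})\right| \le C\delta_n.$$ If $n$ is odd, then $\Pr[\operatorname{disc}(M) = 0] = 0$, $$\left|\Pr[\operatorname{disc}(M) = 1] - \Pr[Y \ge t \mid Y \equiv t \bmod 2]\right| \le C\delta_n,$$ $$\left|\Pr[\operatorname{disc}(M) = 2] - \Pr[Y < t \mid Y \equiv t \bmod 2]\right| \le C\delta_n.$$ (Here $\Pr[Y \le s \mid Y \equiv t \bmod 2] = 2^{-m+1}\sum_{0\le k \le s,\ k \equiv t \bmod 2} \binom{m}{k}$.)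
   Context: An $m \times n$ random $t$-sparse matrix is a matrix whose $n$ columns are independent, each chosen uniformly at random from the set of vectors in $\{0,1\}^m$ with exactly $t$ ones and $m-t$ zeroes. For a real $m\times n$ matrix $M$, $\operatorname{disc}(M) = \min_{v \in \{+1,-1\}^n}\|Mv\|_\infty$. *)

(* Defs.v *)
From HB Require Import structures.
From mathcomp Require Import all_boot all_order all_algebra.
From mathcomp Require Import all_classical all_reals all_analysis.
Set Implicit Arguments.
Unset Strict Implicit.
Unset Printing Implicit Defensive.
Import Order.TTheory GRing.Theory Num.Theory numFieldNormedType.Exports.
Local Open Scope classical_set_scope.
Local Open Scope ring_scope.

Definition signs (R : realType) (n : nat) (b : 'I_n -> bool) : 'cV[R]_n :=
  \col_j (-1) ^+ b j.

(* The norm of MathComp-Analysis on matrices is the sup norm.  The default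
   value of the iterated minimum is the value at the all-ones vector, which is
   itself a sign vector; see [disc_min]. *)
Definition disc (R : realType) (m n : nat) (M : 'M[R]_(m, n)) : R :=
  \big[Num.min/ `|M *m (const_mx 1 : 'cV[R]_n)|]_(b : {ffun 'I_n -> bool}) `|M *m signs R b|.

Lemma signsP (R : realType) (n : nat) (v : 'cV[R]_n) :
  (forall j, v j 0 = 1 \/ v j 0 = -1) <->
  exists b : {ffun 'I_n -> bool}, v = signs R b.
Proof.
split=> [hv|[b ->] j]; last first.
  by rewrite mxE; case: (b j); [right | left].
exists [ffun j => v j 0 == -1]; apply/colP => j; rewrite mxE ffunE.
case: (hv j) => ->; last by rewrite eqxx expr1.
by rewrite -subr_eq0 opprK -mulr2n pnatr_eq0 expr0.
Qed.

Lemma disc_min (R : realType) (m n : nat) (M : 'M[R]_(m, n)) :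
  (exists2 v : 'cV[R]_n, forall j, v j 0 = 1 \/ v j 0 = -1 & disc M = `|M *m v|)
  /\ forall v : 'cV[R]_n, (forall j, v j 0 = 1 \/ v j 0 = -1) ->
       disc M <= `|M *m v|.
Proof.
split; last by move=> v /signsP[b ->]; exact: bigmin_le_cond.
rewrite /disc; elim/big_ind: _ => [|x y [u hu ->] [v hv ->]|b _].
- by exists (const_mx 1) => // j; left; rewrite mxE.
- by rewrite minElt; case: ifP => _; [exists u | exists v].
- by exists (signs R b) => //; apply/signsP; exists b.
Qed.

(* [Pr] and [condPr] take any set function, e.g. a probability measure on a
   sample space or the law of a random variable. *)
Definition Pr (R : realType) (T : Type) (P : set T -> \bar R) (A : set T) : R :=
  fine (P A).

Definition condPr (R : realType) (T : Type) (P : set T -> \bar R)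
    (A B : set T) : R :=
  Pr P (A `&` B) / Pr P B.

Definition sparse_vectors (m t : nat) : {set 'cV[bool]_m} :=
  [set x : 'cV[bool]_m | #|[set i | x i ord0]%SET| == t]%SET.

Section RandomSparse.
Variables (R : realType) (d : measure_display) (T : measurableType d).
Variable P : probability T R.

(* Random elements of a finite type, equipped with the discrete sigma-algebra *)
Definition random_element (U : finType) (X : T -> U) : Prop :=
  forall x : U, measurable [set w | X w = x].

Definition uniform_on (U : finType) (S : {set U}) (X : T -> U) : Prop :=
  forall x : U, Pr P [set w | X w = x] = if x \in S then #|S|%:R^-1 else 0.

(* Subfamilies are covered, since any [B j] may be the full set. *)
Definition independent (I U : finType) (X : I -> T -> U) : Prop :=
  forall B : I -> {set U},
    Pr P [set w | forall j, X j w \in B j] =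
    \prod_j Pr P [set w | X j w \in B j].

Definition random_sparse (m n t : nat) (M : T -> 'M[bool]_(m, n)) : Prop :=
  [/\ random_element M,
      independent (fun (j : 'I_n) w => col j (M w)) &
      forall j, uniform_on (sparse_vectors m t) (fun w => col j (M w))].

End RandomSparse.

Definition real_mx (R : realType) (m n : nat) (A : 'M[bool]_(m, n)) :
    'M[R]_(m, n) :=
  map_mx (fun b : bool => (b : nat)%:R) A.

Definition Pr_disc (R : realType) (d : measure_display) (T : measurableType d)
    (P : probability T R) (m n : nat) (M : T -> 'M[bool]_(m, n)) (k : nat) : R :=
  Pr P [set w | disc (real_mx R (M w)) = k%:R].

Lemma Pr_binomial_half (R : realType) (m : nat) (p : pred nat) :
  Pr (binomial_prob m (2^-1 : R)) [set k | p k] =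
  2 ^- m * \sum_(0 <= k < m.+1 | p k) ('C(m, k))%:R.
Proof.
have p0 : 0 <= 2^-1 :> R by rewrite invr_ge0.
have p1 : (NngNum p0)%:num <= 1 by rewrite /= invf_le1 ?ler1n.
rewrite big_mkcond big_mkord mulr_sumr /Pr (binomial_probE m p1).
rewrite -[RHS]/(fine (EFin _)) -sumEFin; congr fine; apply: eq_bigr => k _ /=.
have half : 1 - 2^-1 = 2^-1 :> R.
  by rewrite [X in X - _](splitr 1) div1r addrK.
rewrite /unstable.onem half -exprD subnKC ?(leq_ord k) // diracE exprVn.
case: ifPn => pk; first by rewrite mulr_natr mem_set //= mule1.
by rewrite memNset ?mule0 ?mulr0 //; apply/negP.
Qed.

Lemma sum_binomial_parity (R : realType) (m t : nat) : (0 < m)%N ->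
  \sum_(0 <= k < m.+1 | k == t %[mod 2]) ('C(m, k))%:R = 2 ^+ m.-1 :> R.
Proof.
move=> m0; have two0 : (2 : R) != 0 by rewrite pnatr_eq0.
have evn : \sum_(i < m.+1) (-1) ^+ i *+ 'C(m, i) = 0 :> R.
  transitivity ((1 - 1 : R) ^+ m); last by rewrite subrr expr0n eqn0Ngt m0.
  by rewrite exprDn; apply: eq_bigr => i _; rewrite expr1n mul1r.
have tot : \sum_(i < m.+1) ('C(m, i))%:R = 2 ^+ m :> R.
  rewrite -[2]/(1 + 1) exprDn; apply: eq_bigr => i _.
  by rewrite !expr1n mul1r.
have evt : \sum_(i < m.+1) (-1) ^+ t * ((-1) ^+ i *+ 'C(m, i)) = 0 :> R.
  by rewrite -mulr_sumr evn mulr0.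
apply: (mulfI two0); rewrite -exprS prednK //.
transitivity (\sum_(i < m.+1) (('C(m, i))%:R +
    (-1) ^+ t * ((-1) ^+ i *+ 'C(m, i))) : R); last first.
  by rewrite big_split /= tot evt addr0.
rewrite big_mkcond big_mkord mulr_sumr; apply: eq_bigr => i _.
rewrite mulrnAr -signr_odd -[(-1) ^+ i]signr_odd !modn2.
by case: (odd i); case: (odd t);
  rewrite /= ?expr0 ?expr1 ?mulN1r ?mul1r ?opprK ?mulNrn ?subrr ?mulr0 //
    mulr_natl mulr2n.
Qed.

Lemma condPr_binomial_le (R : realType) (m t s : nat) : (0 < m)%N ->
  condPr (binomial_prob m (2^-1 : R)) [set k | (k <= s)%N] [set k | k = t %[mod 2]]
  = 2 ^- m.-1 * \sum_(0 <= k < s.+1 | k == t %[mod 2]) ('C(m, k))%:R.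
Proof.
move=> m0; rewrite /condPr.
have -> : [set k | k = t %[mod 2]] = [set k | k == t %[mod 2]].
  by apply/seteqP; split=> k /= /eqP.
have -> : [set k | (k <= s)%N] `&` [set k | k == t %[mod 2]] =
    [set k | (k == t %[mod 2]) && (k < s.+1)%N].
  by apply/seteqP; split=> k /=; [case=> ks ->; rewrite ltnS | case/andP=> ->].
rewrite !Pr_binomial_half (sum_binomial_parity _ t m0) invfM invrK.
rewrite mulrACA mulVf ?expf_neq0 ?pnatr_eq0 // mul1r mulrC; congr (_ * _).
rewrite (big_nat_widen 0 m.+1 (maxn m s).+1) ?ltnS ?leq_maxl //.
rewrite (big_nat_widen 0 s.+1 (maxn m s).+1) ?ltnS ?leq_maxr //.
rewrite big_mkcond [RHS]big_mkcond; apply: eq_bigr => k _.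
by case: (ltnP k m.+1) => [|/bin_small ->]; rewrite ?andbT ?andbF //; case: ifP.
Qed.

(* Main.v *)
Require Import Defs.
From HB Require Import structures.
From mathcomp Require Import all_boot all_order all_algebra.
From mathcomp Require Import perm.
From mathcomp Require Import all_classical all_reals all_analysis.
From mathcomp Require Import zify ring lra.
Import Order.TTheory GRing.Theory Num.Theory numFieldNormedType.Exports.
Local Open Scope classical_set_scope.
Local Open Scope ring_scope.
Set Implicit Arguments.
Unset Strict Implicit.
Unset Printing Implicit Defensive.

(** Sign vectors [v] with [M v = y] are counted by Fourier inversion on the
    group (Z/n)^(m+1): one frequency [al i] in (1/n)Z for each row, and one
    frequency [be] for the sum of the signs, which must be [s = (sum of y) / t]
    because every column of [M] sums to [t].  Summing over the signs first, the
    number of solutions times n^(m+1) is 2^n times the sum over all frequencies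
    of [cos (pi (<al, y> + be s))] times the product over the columns [x] of
    [cos (pi (be + <al, x>))].  The zero frequency contributes 1; it suffices
    that the other terms cannot cancel it.  A frequency is measured by
    [Q = E sin^2 (pi (be + <al, x>))], where [x] is a random column.

    - If [Q <= 1 / (1024 m^2)], the term is nonnegative.  Exchanging two
      coordinates of [x] shows that all [al i] agree nearly modulo 1, so that
      modulo 1 the phase [be + <al, x>] is a real form [ka + <u, x>] with
      [sum u = 0] which never exceeds 1/2 in absolute value ([small_lift]).
      As this form is a true lift, its variance controls [sum u_i^2], hence also
      the phase at [y], which stays below 1/2 when the entries of [y] are at
      most 2 ([near_sum_ge0]).
    - Otherwise the mean of the absolute value of the product is at most
      (1 - Q/2)^n <= exp (- n / (2048 m^2)).  There are n^(m+1) frequencies, and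
      [n >= c m^3 log^2 m] makes the sum of all these means at most 1/n, so by
      Markov the far terms add up to less than 1 outside an event of
      probability at most 1/n ([sum_weight_bad]).

    Hence, outside this event, every small [y] with the parities of the row sums
    of [M], and whose sum is 0 or [t] according to the parity of [n], is [M v] for
    a sign vector [v] ([exists_signs]).  The discrepancy is then a function of
    the set [S] of rows with an odd sum.  For [n] even it is 0 if [S] is empty
    and 1 otherwise.  For [n] odd the entries of [M v] sum to an odd multiple of
    [t]; entries in {-1, 0, 1} reach this only if [t <= |S|], so the discrepancy
    is 1 if [t <= |S|], and 2 otherwise.

    Finally [S] is almost uniform among the sets whose size has the parity of
    [t n]: by Fourier analysis on (Z/2)^m, each of the characters other than
    the two constant ones has mean at most 1 - 1/m in absolute value under a
    column, so that each set has the right probability up to exp (- n / m)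
    ([sum_weight_odd_rows]).  Both errors are at most 1/n, which is below
    [sqrt ((m / n) log n)]. *)

(** * Trigonometric inequalities *)

Lemma cosD2pi_int (R : realType) (x : R) (k : int) :
  cos (x + 2 * pi * k%:~R) = cos x.
Proof.
have cosp (y : R) (n : nat) : cos (y + 2 * pi * n%:R) = cos y.
  by rewrite -(periodicn (@cosD2pi R) n y) -[in RHS]mulr_natr -[in RHS](mulr_natl pi).
case: k => n; first exact: cosp.
rewrite NegzE mulrNz mulrN -(cosp _ n.+1) subrK //.
Qed.

Lemma sinD2pi_int (R : realType) (x : R) (k : int) :
  sin (x + 2 * pi * k%:~R) = sin x.
Proof. by rewrite -!cosBpihalf addrAC cosD2pi_int. Qed.

(** Since cos^2 = 1 - sin^2 <= (1 - sin^2 / 2)^2.  This turns the mean of a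
    cosine into the mean of a squared sine, for which exchange arguments and
    second moments are available. *)
Lemma norm_cos_le (R : realType) (x : R) : `|cos x| <= 1 - sin x ^+ 2 / 2.
Proof.
rewrite sin2cos2; have := sqr_ge0 (`|cos x| - 1).
rewrite -(real_normK (num_real (cos x))); have := normr_ge0 (cos x); nra.
Qed.

Lemma norm_sin_le (R : realType) (x : R) : `|sin x| <= `|x|.
Proof.
have pos (y : R) : 0 < y -> `|sin y| <= `|y|.
  move=> y0.
  have [|c _] := @MVT R sin cos 0 y y0.
    by apply: continuous_subspaceT => z; exact: continuous_sin.
  rewrite sin0 !subr0 => ->; rewrite normrM ler_piMl //; exact: cos_max.
case: (ltgtP x 0) => [x0|x0|->]; last by rewrite sin0.
- by rewrite -normrN -sinN -(normrN x); apply: pos; rewrite oppr_gt0.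
- exact: pos.
Qed.

(** A Jordan inequality.  Below 1/4 it is the mean value theorem with
    cos >= cos (pi / 4) >= 1/2; above, sin is at least sin (pi / 4) >= 1/2. *)
Lemma sin_pi_ge (R : realType) (w : R) : 0 <= w -> w <= 1 / 2 -> w <= sin (pi * w).
Proof.
move=> w0 w1.
have pi2 := @pi_ge2 R.
have c4 : cos (pi / 4 : R) ^+ 2 = 1 / 2.
  have := cos_mulr2n (pi / 4 : R).
  have -> : (pi / 4 : R) *+ 2 = pi / 2 by rewrite -mulr_natr; field.
  rewrite cos_pihalf; lra.
have c40 : 0 < cos (pi / 4 : R) by apply: cos_gt0_pihalf; lra.
have c4h : 1 / 2 <= cos (pi / 4 : R) by nra.
have s4 : sin (pi / 4 : R) ^+ 2 = 1 / 2 by rewrite sin2cos2 c4; lra.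
have s40 : 0 < sin (pi / 4 : R) by apply: sin_gt0_pihalf; lra.
have s4h : 1 / 2 <= sin (pi / 4 : R) by nra.
have [w4|w4] := leP (1 / 4) w.
  apply: (le_trans w1); apply: (le_trans s4h).
  have [->|ne] := eqVneq w (1 / 4); first by rewrite mulrA mulr1.
  apply/ltW; rewrite ltr_sin ?in_itv /=; first by nra.
  - by apply/andP; split; nra.
  - by apply/andP; split; nra.
have [->|wn] := eqVneq w 0; first by rewrite mulr0 sin0.
have wp : 0 < w by rewrite lt0r wn.
have pw : 0 < pi * w by nra.
have [|c] := @MVT R sin cos 0 (pi * w) pw.
  by apply: continuous_subspaceT => z; exact: continuous_sin.
rewrite sin0 !subr0 in_itv /= => /andP[c0 c1] ->.
have cc : cos (pi / 4) <= cos c.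
  by apply/ltW; rewrite ltr_cos ?in_itv /=; [nra|apply/andP; split; nra|apply/andP; split; nra].
nra.
Qed.

Lemma sin2_pi_ge (R : realType) (w : R) : `|w| <= 1 / 2 -> w ^+ 2 <= sin (pi * w) ^+ 2.
Proof.
move=> w1; have := sin_pi_ge (normr_ge0 w) w1.
have -> : sin (pi * w) ^+ 2 = sin (pi * `|w|) ^+ 2.
  by have [_|_] := ger0P w => //; rewrite mulrN sinN sqrrN.
rewrite -(real_normK (num_real w)) => h; have := normr_ge0 w; nra.
Qed.

Lemma sin2_pi_le (R : realType) (w : R) : sin (pi * w) ^+ 2 <= 16 * w ^+ 2.
Proof.
have := norm_sin_le (pi * w); rewrite normrM (gtr0_norm (pi_gt0 R)).
have := @pihalf_lt2 R; have := @pi_ge2 R; have := normr_ge0 w.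
rewrite -(real_normK (num_real w)) -(real_normK (num_real (sin _))).
move: (`|sin _|) (normr_ge0 (sin (pi * w))) (`|w|) => s s0 {}w w0 p2 p4 h.
have : s <= 4 * w by nra.
nra.
Qed.

Lemma sin2B_le (R : realType) (x y : R) :
  sin (x - y) ^+ 2 <= 2 * sin x ^+ 2 + 2 * sin y ^+ 2.
Proof.
rewrite sinB; have := sin2cos2 x; have := sin2cos2 y.
have := sqr_ge0 (sin x * cos y + cos x * sin y).
have := sqr_ge0 (cos x); have := sqr_ge0 (cos y).
have := sqr_ge0 (sin x); have := sqr_ge0 (sin y).
set a := sin x; set b := cos x; set c := sin y; set d := cos y => *.
nra.
Qed.

Lemma sin2_pi_int (R : realType) (x : R) (k : int) :
  sin (pi * (x + k%:~R)) ^+ 2 = sin (pi * x) ^+ 2.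
Proof.
have h (y : R) : sin y ^+ 2 = (1 - cos (2 * y)) / 2.
  by rewrite mulr_natl cos_mulr2n sin2cos2 mulr2n; field.
rewrite !h; congr ((1 - _) / 2).
rewrite -(cosD2pi_int (2 * (pi * x)) k); congr cos; ring.
Qed.

Lemma near_int (R : realType) (x : R) : exists k : int, `|x - k%:~R| <= 1 / 2.
Proof.
exists (Num.floor (x + 1 / 2)).
have := floor_le (x + 1 / 2); have := floorD1_gt (x + 1 / 2).
rewrite intrD => *; rewrite ler_norml; apply/andP; split; lra.
Qed.

(** * Averages over sparse vectors *)

Definition mean (R : realType) (U : finType) (S : {set U}) (h : U -> R) : R :=
  #|S|%:R^-1 * \sum_(x in S) h x.

Definition lin (R : realType) (m : nat) (u : 'I_m -> R) (x : 'cV[bool]_m) : R :=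
  \sum_i u i * (x i ord0)%:R.

(** The variance of [lin u x] for uniform sparse [x] is this constant times
    [sum u_i^2], as soon as [sum u_i = 0]; see [mean_lin_sq]. *)
Definition spread (R : realType) (m t : nat) : R :=
  t%:R * (m%:R - t%:R) / (m%:R * (m%:R - 1)).

Section Mean.
Variables (R : realType) (U : finType) (S : {set U}).
Implicit Types (h : U -> R).

Lemma mean_ge0 h : (forall x, x \in S -> 0 <= h x) -> 0 <= mean S h.
Proof. by move=> h0; rewrite mulr_ge0 ?invr_ge0 ?ler0n ?sumr_ge0. Qed.

Lemma eq_mean h1 h2 : {in S, h1 =1 h2} -> mean S h1 = mean S h2.
Proof. by move=> eqh; congr (_ * _); apply: eq_bigr. Qed.

Lemma le_mean h1 h2 : (forall x, x \in S -> h1 x <= h2 x) -> mean S h1 <= mean S h2.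
Proof. by move=> leh; rewrite ler_wpM2l ?invr_ge0 ?ler_sum. Qed.

Lemma meanD h1 h2 : mean S (fun x => h1 x + h2 x) = mean S h1 + mean S h2.
Proof. by rewrite /mean big_split mulrDr. Qed.

Lemma meanZ c h : mean S (fun x => c * h x) = c * mean S h.
Proof. by rewrite /mean -mulr_sumr mulrCA. Qed.

Lemma mean_sum (I : finType) (P : pred I) (h : I -> U -> R) :
  mean S (fun x => \sum_(i | P i) h i x) = \sum_(i | P i) mean S (h i).
Proof. by rewrite /mean exchange_big mulr_sumr. Qed.

Hypothesis S0 : (0 < #|S|)%N.

Lemma mean_cst (c : R) : mean S (fun=> c) = c.
Proof.
by rewrite /mean sumr_const -(mulr_natl c) mulrA mulVf ?mul1r // pnatr_eq0 -lt0n.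
Qed.

End Mean.

Section Sparse.
Variables (R : realType) (m t : nat).
Hypotheses (t0 : (0 < t)%N) (tm : (t < m)%N).
Local Notation S := (sparse_vectors m t).

Lemma sparse_sumn x : x \in S -> (\sum_i x i ord0)%N = t.
Proof.
rewrite inE => /eqP <-; rewrite cardsE -sum1_card [RHS]big_mkcond.
apply: eq_bigr => i _; change ((x i ord0 : nat) = if x i ord0 then 1%N else 0%N).
by case: (x i ord0).
Qed.

Lemma sparse_sum x : x \in S -> \sum_i ((x i ord0)%:R : R) = t%:R.
Proof. by move=> /sparse_sumn <-; rewrite natr_sum. Qed.

Lemma card_sparse_gt0 : (0 < #|S|)%N.
Proof.
apply/card_gt0P; exists (\col_i (i < t)%N); rewrite inE; apply/eqP.
rewrite cardsE -sum1_card (eq_bigl (fun i : 'I_m => (i < t)%N)) => [|i]; last first.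
  by rewrite -[LHS]/((\col_(k < m) (k < t)%N) i ord0) mxE.
by rewrite (big_ord_narrow (ltnW tm)) sum1_card card_ord.
Qed.

Lemma sparse_swap (i j : 'I_m) x : (xrow i j x \in S) = (x \in S).
Proof.
rewrite !inE; congr (_ == _).
rewrite -(card_preimset _ (@perm_inj _ (tperm i j))); apply: eq_card => k.
by rewrite !inE mxE tpermK.
Qed.

Lemma mean_swap (i j : 'I_m) (h : 'cV[bool]_m -> R) :
  mean S h = mean S (fun x => h (xrow i j x)).
Proof.
rewrite /mean (reindex_inj (inv_inj (_ : involutive (xrow i j)))) /=.
  by under eq_bigl => x do rewrite sparse_swap.
by move=> x; rewrite /xrow -row_permM tperm2 row_perm1.
Qed.

Lemma mean_lin0 (u : 'I_m -> R) : \sum_i u i = 0 -> mean S (lin u) = 0.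
Proof.
move=> u0; have i0 : 'I_m by apply: (@Ordinal m 0); apply: leq_ltn_trans tm.
rewrite mean_sum.
transitivity (\sum_i u i * mean S (fun x => ((x i0 ord0)%:R : R))).
  apply: eq_bigr => i _; rewrite meanZ; congr (_ * _).
  by rewrite (mean_swap i i0); apply: eq_mean => x _; rewrite mxE tpermL.
by rewrite -mulr_suml u0 mul0r.
Qed.

(** All pairs of distinct coordinates play the same role, so each squared
    difference has the mean of their sum, which is the constant 2 t (m - t). *)
Lemma mean_diff2 (i j : 'I_m) : i != j ->
  mean S (fun x => ((x i ord0)%:R - (x j ord0)%:R : R) ^+ 2) = 2 * spread R m t.
Proof.
pose d i j := mean S (fun x => ((x i ord0)%:R - (x j ord0)%:R : R) ^+ 2).
have dC k l : d k l = d l k by apply: eq_mean => x _; rewrite -sqrrN opprB.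
have d1 k l l' : l != k -> l' != k -> d k l = d k l'.
  move=> lk lk'; rewrite /d (mean_swap l l'); apply: eq_mean => x _.
  by rewrite !mxE tpermL tpermD.
have d2 k l : i != j -> k != l -> d k l = d i j.
  move=> ij kl; have lk : l != k by rewrite eq_sym.
  have [jk|jk] := eqVneq j k; first by rewrite -jk (dC i) in lk *; exact: d1.
  by rewrite (d1 k l j) // (dC i) (dC k); apply: d1; rewrite // eq_sym.
move=> ij; change (d i j = 2 * spread R m t).
have sq (b : bool) : (b%:R : R) ^+ 2 = b%:R by case: b; rewrite ?expr1n ?expr0n.
have tot : \sum_k \sum_l d k l = 2 * (m%:R * t%:R - t%:R ^+ 2).
  under eq_bigr => k _ do rewrite -mean_sum.
  rewrite -mean_sum -[RHS](mean_cst card_sparse_gt0); apply: eq_mean => x xS.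
  have vrow k : \sum_l ((x k ord0)%:R - (x l ord0)%:R : R) ^+ 2 =
      (m%:R - 2 * t%:R) * (x k ord0)%:R + t%:R.
    transitivity (\sum_l ((x k ord0)%:R + - 2 * (x k ord0)%:R * (x l ord0)%:R
       + (x l ord0)%:R : R)).
      by apply: eq_bigr => l _; rewrite sqrrB !sq; ring.
    rewrite big_split big_split /= -mulr_sumr (sparse_sum xS).
    by rewrite sumr_const card_ord -(mulr_natl _ m); ring.
  rewrite (eq_bigr _ (fun k _ => vrow k)) big_split /= -mulr_sumr (sparse_sum xS).
  by rewrite sumr_const card_ord -(mulr_natl _ m); ring.
have m1 : (m%:R : R) - 1 != 0.
  rewrite subr_eq0 pnatr_eq1; apply/negP => /eqP m1.
  by move: t0 tm; rewrite m1; lia.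
have m0 : (m%:R : R) != 0 by rewrite pnatr_eq0; move: t0 tm; lia.
have tot2 : \sum_k \sum_l d k l = m%:R * (m%:R - 1) * d i j.
  transitivity (\sum_(k < m) (m%:R - 1) * d i j).
    apply: eq_bigr => k _; rewrite (bigD1 k) //=.
    have -> : d k k = 0.
      by rewrite -[RHS](mean_cst card_sparse_gt0); apply: eq_mean => x _; rewrite subrr expr0n.
    rewrite add0r (eq_bigr (fun=> d i j)) => [|l lk]; last by apply: d2; rewrite // eq_sym.
    by rewrite sumr_const cardC1 card_ord -[LHS]mulr_natl -subn1 natrB //; move: t0 tm; lia.
  by rewrite sumr_const card_ord -[LHS]mulr_natl mulrA.
rewrite tot2 in tot; rewrite /spread; apply: (mulfI (mulf_neq0 m0 m1)).
by rewrite tot; field; rewrite m0 m1.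
Qed.

(** When the [u i] sum to zero, [(lin u x)^2] is minus half the sum of the
    [u i u j (x i - x j)^2], so that [mean_diff2] gives the second moment without
    computing joint moments of the coordinates. *)
Lemma mean_lin_sq (c : R) (u : 'I_m -> R) : \sum_i u i = 0 ->
  mean S (fun x => (c + lin u x) ^+ 2) = c ^+ 2 + spread R m t * \sum_i u i ^+ 2.
Proof.
move=> u0.
have linE x : lin u x ^+ 2 = \sum_i \sum_j
   - (u i * u j / 2) * ((x i ord0)%:R - (x j ord0)%:R) ^+ 2.
  pose v i : R := (x i ord0)%:R.
  have vrow i : \sum_j - (u i * u j / 2) * (v i - v j) ^+ 2 =
      - (\sum_j u j * v j ^+ 2) / 2 * u i + lin u x * (u i * v i).
    transitivity (\sum_j (- (u i / 2 * v i ^+ 2) * u j - u i / 2 * (u j * v j ^+ 2)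
        + u i * v i * (u j * v j))).
      by apply: eq_bigr => j _; field.
    by rewrite !big_split /= sumrN -!mulr_sumr u0 /lin; field.
  rewrite (eq_bigr _ (fun i _ => vrow i)) big_split /= -!mulr_sumr u0.
  by rewrite mulr0 add0r expr2.
transitivity (mean S (fun x => (c ^+ 2 + 2 * c * lin u x) + lin u x ^+ 2)).
  by apply: eq_mean => x _; ring.
rewrite !meanD meanZ mean_lin0 // mulr0 addr0 mean_cst ?card_sparse_gt0 //.
congr (_ + _); rewrite (eq_mean (fun x _ => linE x)) mean_sum.
transitivity (\sum_i \sum_j - (u i * u j / 2) * (if i == j then 0 else 2 * spread R m t)).
  apply: eq_bigr => i _; rewrite mean_sum; apply: eq_bigr => j _; rewrite meanZ; congr (_ * _).
  have [->|ij] := eqVneq i j; last exact: mean_diff2.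
  by rewrite -[RHS](mean_cst card_sparse_gt0); apply: eq_mean => x _; rewrite subrr expr0n.
transitivity (\sum_i ((- u i * spread R m t) * \sum_j u j + u i ^+ 2 * spread R m t)).
  apply: eq_bigr => i _; rewrite (bigD1 i) //= [X in _ * X + _](bigD1 i) //=.
  rewrite eqxx mulr0 add0r mulrDr.
  rewrite addrAC mulr_sumr (_ : - u i * spread R m t * u i + _ = 0) ?add0r; last by ring.
  by apply: eq_bigr => j ji; rewrite eq_sym (negPf ji); field.
by rewrite big_split /= u0 mulr_sumr; under eq_bigr do rewrite mulr0; rewrite big1_eq add0r;
   apply: eq_bigr => i _; rewrite mulrC.
Qed.

Lemma spread_ge : 1 <= m%:R * spread R m t.
Proof.
have m2 : (2 <= m)%N by apply: leq_trans tm.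
have M2 : (2 : R) <= m%:R by rewrite ler_nat.
have T1 : (1 : R) <= t%:R by rewrite ler1n.
have T2 : (t%:R : R) + 1 <= m%:R by rewrite natr1 ler_nat.
rewrite (_ : _ * _ = t%:R * (m%:R - t%:R) / (m%:R - 1)); last first.
  by rewrite /spread; field; apply/andP; split; apply/eqP; lra.
by rewrite ler_pdivlMr; nra.
Qed.

(** Exchanging coordinates [i] and [j] of [x] preserves the uniform law and moves
    the phase by [u i - u j] whenever [x i] and [x j] differ.  Hence if the phase
    is almost integral for most [x], so is [u i - u j]. *)
Lemma swap_bound (b : R) (u : 'I_m -> R) (i j : 'I_m) : i != j ->
  spread R m t / 2 * sin (pi * (u i - u j)) ^+ 2 <= mean S (fun x => sin (pi * (b + lin u x)) ^+ 2).
Proof.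
move=> ij; set f := fun x => sin (pi * (b + lin u x)) ^+ 2.
have dlin x : lin u x - lin u (xrow i j x) = (u i - u j) * ((x i ord0)%:R - (x j ord0)%:R).
  rewrite /lin (bigD1 i) //= (bigD1 j) 1?eq_sym //=.
  rewrite [X in _ - X](bigD1 i) //= [X in _ - (_ + X)](bigD1 j) 1?eq_sym //=.
  rewrite !mxE tpermL tpermR (eq_bigr (fun k => u k * (xrow i j x k ord0)%:R)); first by ring.
  by move=> k /andP[ki kj]; rewrite mxE tpermD 1?eq_sym.
suff : mean S (fun x => ((x i ord0)%:R - (x j ord0)%:R) ^+ 2 * sin (pi * (u i - u j)) ^+ 2)
    <= 2 * mean S f + 2 * mean S (fun x => f (xrow i j x)).
  rewrite -mean_swap; under [mean S _]eq_mean do rewrite mulrC.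
  by rewrite meanZ mean_diff2 //; lra.
rewrite -!meanZ -meanD; apply: le_mean => x _.
apply: le_trans (sin2B_le _ _).
rewrite -mulrBr opprD addrACA subrr add0r dlin.
case: (x i ord0); case: (x j ord0); rewrite /= ?subrr ?subr0 ?sub0r ?mulr0 ?mulr1 ?mulrN1 ?sqrrN
  ?expr1n ?expr0n /= ?mul0r ?mul1r ?sqr_ge0 // mulrN sinN sqrrN //.
Qed.
End Sparse.

(** * Lifting an almost integral phase to a real form *)

Lemma cauchy_schwarz_sum (R : realType) (I : finType) (f g : I -> R) :
  (\sum_i f i * g i) ^+ 2 <= (\sum_i f i ^+ 2) * (\sum_i g i ^+ 2).
Proof.
have : 0 <= \sum_i \sum_j (f i * g j - f j * g i) ^+ 2.
  by apply: sumr_ge0 => i _; apply: sumr_ge0 => j _; exact: sqr_ge0.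
have vrow i : \sum_j (f i * g j - f j * g i) ^+ 2 =
   (\sum_j g j ^+ 2) * f i ^+ 2 + (\sum_j f j ^+ 2) * g i ^+ 2
   - 2 * (\sum_j f j * g j) * (f i * g i).
  transitivity (\sum_j (f i ^+ 2 * g j ^+ 2 + g i ^+ 2 * f j ^+ 2 - 2 * (f i * g i) * (f j * g j))).
    by apply: eq_bigr => j _; ring.
  by rewrite !big_split /= sumrN -!mulr_sumr; ring.
rewrite (eq_bigr _ (fun i _ => vrow i)) !big_split /= sumrN -!mulr_sumr; lra.
Qed.

Lemma sum_center_sq (R : realType) (m : nat) (u : 'I_m -> R) : (0 < m)%N ->
  let u' := fun i => u i - (\sum_j u j) / m%:R in
  \sum_i u' i = 0 /\ \sum_i u' i ^+ 2 <= \sum_i u i ^+ 2.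
Proof.
move=> m0 u'; set s := \sum_j u j.
have M0 : (m%:R : R) != 0 by rewrite pnatr_eq0 -lt0n.
have Mp : 0 < (m%:R : R) by rewrite ltr0n.
split; first by rewrite /u' sumrB sumr_const card_ord -mulr_natr; field.
rewrite (_ : \sum_i u' i ^+ 2 = \sum_i u i ^+ 2 - s ^+ 2 / m%:R).
  by rewrite lerBlDr lerDl divr_ge0 ?sqr_ge0 ?ltW.
transitivity (\sum_i (u i ^+ 2 + - (2 * s / m%:R) * u i + s ^+ 2 / m%:R ^+ 2)).
  by apply: eq_bigr => i _; rewrite /u' -/s; field.
by rewrite !big_split /= -mulr_sumr sumr_const card_ord -/s -mulr_natr; field.
Qed.

Section Lift.
Variables (R : realType) (m t : nat).
Hypotheses (t0 : (0 < t)%N) (tm : (t < m)%N).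
Local Notation S := (sparse_vectors m t).

Let M0 : (0 : R) < m%:R.
Proof. by rewrite ltr0n; apply: leq_ltn_trans tm. Qed.

Let M2 : (2 : R) <= m%:R.
Proof. by rewrite ler_nat; apply: leq_trans tm. Qed.

(** Cauchy-Schwarz against the centered vector [x - t / m], whose squared norm
    is t (m - t) / m. *)
Lemma lin_sq_le (u : 'I_m -> R) x : \sum_i u i = 0 -> x \in S ->
  lin u x ^+ 2 <= (m%:R - 1) * (spread R m t * \sum_i u i ^+ 2).
Proof.
move=> u0 xS; pose v i : R := (x i ord0)%:R - t%:R / m%:R.
have -> : lin u x = \sum_i u i * v i.
  rewrite /v; under [RHS]eq_bigr do rewrite mulrBr.
  by rewrite sumrB -mulr_suml u0 mul0r subr0.
apply: le_trans (cauchy_schwarz_sum _ _) _.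
have sq (b : bool) : (b%:R : R) ^+ 2 = b%:R by case: b; rewrite ?expr1n ?expr0n.
have -> : \sum_i v i ^+ 2 = (m%:R - 1) * spread R m t.
  transitivity (\sum_i ((1 - 2 * t%:R / m%:R) * (x i ord0)%:R + t%:R ^+ 2 / m%:R ^+ 2 : R)).
    apply: eq_bigr => i _; rewrite /v sqrrB sq; field; exact: lt0r_neq0.
  rewrite big_split /= -mulr_sumr (sparse_sum _ xS) sumr_const card_ord -[X in _ + X]mulr_natr.
  by rewrite /spread; field; apply/andP; split; apply/eqP; move: M0 M2; lra.
by rewrite mulrC -mulrA.
Qed.

(** If the phase [be + lin al x] is almost integral on average, then up to
    integer shifts of [al] and [be] and a shift of all [al i] by a common [rho],
    compensated in [be], it is the small real form [ka + lin u x].  [swap_bound]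
    gives a first bound on [sum u_i^2], weak by a factor [m] but enough to keep
    the form below 1/2 at every sparse [x].  There sin^2 (pi w) >= w^2, and the
    exact variance of the form yields the sharp bound in the conclusion. *)
Lemma small_lift (al : 'I_m -> R) (be : R) :
  let Q := mean S (fun x => sin (pi * (be + lin al x)) ^+ 2) in
  m%:R ^+ 2 * Q <= 1 / 1024 ->
  exists (u : 'I_m -> R) (ka rho : R) (k : 'I_m -> int) (l : int),
    [/\ forall i, al i = rho + u i + (k i)%:~R,
        be = ka - t%:R * rho + l%:~R,
        forall x, x \in S -> `|ka + lin u x| <= 1 / 2,
        `|ka| <= 1 / 3 & spread R m t * \sum_i u i ^+ 2 <= Q].
Proof.
move=> Q Qsmall; pose a := spread R m t.
have Q0 : 0 <= Q by apply: mean_ge0 => x _; exact: sqr_ge0.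
have a0 : 0 < a.
  have := spread_ge R t0 tm; rewrite -/a => h; rewrite -(pmulr_rgt0 _ M0); lra.
have S0 := card_sparse_gt0 tm.
pose i0 : 'I_m := Ordinal (leq_ltn_trans (leq0n t) tm).
have [k kP] := choice (fun i => near_int (al i - al i0)).
pose u1 i := al i - al i0 - (k i)%:~R.
have u1Q i : a * u1 i ^+ 2 <= 2 * Q.
  have h : u1 i ^+ 2 <= sin (pi * (al i - al i0)) ^+ 2.
    by rewrite -(sin2_pi_int _ (- k i)) mulrNz; apply: sin2_pi_ge; exact: kP.
  have [ii|ii] := eqVneq i i0.
    have -> : u1 i ^+ 2 = 0.
      apply/eqP; rewrite eq_le sqr_ge0 andbT; apply: le_trans h _.
      by rewrite ii subrr mulr0 sin0 expr0n.
    by rewrite mulr0; lra.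
  have := swap_bound t0 tm be al ii; rewrite -/Q -/a; nra.
(* Centering makes Cauchy-Schwarz against [x - t / m] available; the average is
   absorbed into [rho] and [ka]. *)
pose av := (\sum_j u1 j) / m%:R.
have [u0 uu1] := sum_center_sq u1 (leq_ltn_trans (leq0n t) tm).
pose u i := u1 i - av.
have {}u0 : \sum_i u i = 0 := u0.
have {}uu1 : \sum_i u i ^+ 2 <= \sum_i u1 i ^+ 2 := uu1.
have uQ : a * \sum_i u i ^+ 2 <= 2 * m%:R * Q.
  apply: le_trans (_ : a * \sum_i u1 i ^+ 2 <= _); first by rewrite ler_pM2l.
  rewrite mulr_sumr; apply: (@le_trans _ _ (\sum_(i < m) 2 * Q)).
    by apply: ler_sum => i _; exact: u1Q.
  by rewrite sumr_const card_ord -mulr_natr; lra.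
have linu x : x \in S -> lin u x ^+ 2 <= 2 * (m%:R ^+ 2 * Q).
  move=> xS; apply: le_trans (lin_sq_le u0 xS) _; rewrite -/a.
  by move: M0 M2 uQ; set s := a * _; nra.
pose rho := al i0 + av.
have alE i : al i = rho + u i + (k i)%:~R by rewrite /u /rho /u1; ring.
have [l lP] := near_int (be + t%:R * rho).
pose ka := be + t%:R * rho - l%:~R.
have beE : be = ka - t%:R * rho + l%:~R by rewrite /ka; ring.
pose kx (x : 'cV[bool]_m) : int := l + \sum_i k i * (x i ord0 : nat)%:Z.
have psiE x : x \in S -> be + lin al x = ka + lin u x + (kx x)%:~R.
  move=> xS; rewrite [in LHS]beE /kx intrD rmorph_sum /=.
  have -> : lin al x = rho * t%:R + lin u x + \sum_i (k i)%:~R * (x i ord0)%:R.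
    rewrite -(sparse_sum _ xS) mulr_sumr -!big_split /=.
    by apply: eq_bigr => i _; rewrite alE; ring.
  rewrite (eq_bigr (fun i => (k i)%:~R * (x i ord0)%:R : R)); first by ring.
  by move=> i _; rewrite intrM.
have QE : Q = mean S (fun x => sin (pi * (ka + lin u x)) ^+ 2).
  by apply: eq_mean => x xS; rewrite psiE // sin2_pi_int.
(* The phase is almost integral on average and [lin u x] is small for every
   [x], so the constant [ka], which is their difference modulo 1, is small. *)
have ka2 : ka ^+ 2 <= 65 * (m%:R ^+ 2 * Q).
  apply: le_trans (sin2_pi_ge lP) _; rewrite -/ka -(mean_cst S0 (sin (pi * ka) ^+ 2)).
  apply: le_trans (_ : mean S (fun x => 2 * sin (pi * (ka + lin u x)) ^+ 2 +
     64 * (m%:R ^+ 2 * Q)) <= _).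
    apply: le_mean => x xS.
    rewrite [X in sin (pi * X) ^+ 2 <= _](_ : _ = ka + lin u x - lin u x); last by ring.
    rewrite mulrBr; apply: le_trans (sin2B_le _ _) _.
    by have := sin2_pi_le (lin u x); have := linu x xS; lra.
  rewrite meanD meanZ -QE mean_cst //.
  have : 4 * Q <= m%:R ^+ 2 * Q by rewrite ler_wpM2r //; move: M2; nra.
  lra.
have kas : `|ka| <= 1 / 3.
  by rewrite -(@ler_pXn2r _ 2) ?nnegrE ?normr_ge0 // real_normK ?num_real //; lra.
have psis x : x \in S -> `|ka + lin u x| <= 1 / 2.
  move=> xS; have h := linu x xS.
  rewrite -(@ler_pXn2r _ 2) ?nnegrE ?normr_ge0 // real_normK ?num_real //.
  have := sqr_ge0 (ka - lin u x); nra.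
exists u, ka, rho, k, l; split => //.
rewrite QE; apply: le_trans (_ : mean S (fun x => (ka + lin u x) ^+ 2) <= _).
  by rewrite mean_lin_sq // -/a; have := sqr_ge0 ka; lra.
by apply: le_mean => x xS; apply: sin2_pi_ge; exact: psis.
Qed.
End Lift.

(** * Counting sign vectors by Fourier inversion *)

(** Flipping the sign of one index [j0] averages cos (c + g + X) and
    cos (c - g + X), which gives the factor cos g; iterate over the indices. *)
Lemma sum_cos_signs (R : realType) (n : nat) (c : R) (g : 'I_n -> R) :
  \sum_(b : {ffun 'I_n -> bool}) cos (c + \sum_j (-1) ^+ b j * g j) =
  2 ^+ n * (cos c * \prod_j cos (g j)).
Proof.
suff gen (r : seq 'I_n) : uniq r ->
    \sum_(b : {ffun 'I_n -> bool}) cos (c + \sum_(j <- r) (-1) ^+ b j * g j) =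
    2 ^+ n * (cos c * \prod_(j <- r) cos (g j)).
  by rewrite -gen ?index_enum_uniq.
elim: r => [_|j0 r IH /= /andP[j0r ur]].
  rewrite (eq_bigr (fun=> cos c)) => [|b _]; last by rewrite big_nil addr0.
  by rewrite big_nil sumr_const mulr1 card_ffun card_bool card_ord -[LHS]mulr_natl natrX.
pose fl (b : {ffun 'I_n -> bool}) := [ffun j => if j == j0 then ~~ b j else b j].
have flK : involutive fl.
  by move=> b; apply/ffunP => j; rewrite !ffunE; case: eqP => // _; rewrite negbK.
set X := fun b : {ffun 'I_n -> bool} => \sum_(j <- r) (-1) ^+ b j * g j.
have Xfl b : X (fl b) = X b.
  rewrite /X !big_seq; apply: eq_bigr => j jr; rewrite ffunE.
  by case: eqP => // jj; rewrite -jj jr in j0r.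
have flip : \sum_(b : {ffun 'I_n -> bool}) cos (c + \sum_(j <- j0 :: r) (-1) ^+ b j * g j) =
   \sum_(b : {ffun 'I_n -> bool}) cos (c + (- ((-1) ^+ b j0 * g j0) + X b)).
  rewrite (reindex_inj (inv_inj flK)); apply: eq_bigr => b _.
  by rewrite big_cons -/(X (fl b)) Xfl ffunE eqxx signrN mulNr.
have two : (2 : R) != 0 by rewrite pnatr_eq0.
apply: (mulfI two); rewrite big_cons mulr2n mulrDl mul1r {1}flip -big_split /=.
transitivity (2 * cos (g j0) * \sum_b cos (c + X b)); last by rewrite IH //; ring.
rewrite mulr_sumr; apply: eq_bigr => b _; rewrite big_cons -/(X b).
rewrite (addrC (- _)) (addrC (_ * g j0)) !addrA cosB (cosD (c + X b)).
by case: (b j0); rewrite ?expr0 ?expr1 ?mulN1r ?mul1r ?cosN ?sinN; ring.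
Qed.

(** A form of orthogonality of characters: a bijection that rotates all angles
    by [g] makes the vector (sum of cosines, sum of sines) a fixed vector of the
    rotation by [g], hence zero when cos g is not 1. *)
Lemma sum_cos_shift (R : realType) (T : finType) (s : T -> T) (f : T -> R) (g : R) :
  injective s -> (forall x, exists k : int, f (s x) = f x + g + 2 * pi * k%:~R) ->
  cos g != 1 -> \sum_x cos (f x) = 0.
Proof.
move=> sI fs g1; pose C := \sum_x cos (f x); pose D := \sum_x sin (f x).
have eC : C = C * cos g - D * sin g.
  rewrite {1}/C (reindex_inj sI) !mulr_suml -sumrB; apply: eq_bigr => x _.
  by have [k ->] := fs x; rewrite cosD2pi_int cosD.
have eD : D = D * cos g + C * sin g.
  rewrite {1}/D (reindex_inj sI) !mulr_suml -big_split; apply: eq_bigr => x _ /=.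
  by have [k ->] := fs x; rewrite sinD2pi_int sinD.
have : ((1 - cos g) ^+ 2 + sin g ^+ 2) * C = 0.
  have h1 : (1 - cos g) * C = - (D * sin g) by move: eC; lra.
  have h2 : (1 - cos g) * D = C * sin g by move: eD; lra.
  rewrite mulrDl expr2 -mulrA h1 mulrN mulrA h2; ring.
move/eqP; rewrite mulf_eq0 => /orP[|/eqP //]; rewrite paddr_eq0 ?sqr_ge0 //.
by rewrite !sqrf_eq0 subr_eq0 eq_sym (negPf g1).
Qed.

Lemma cos_neq1 (R : realType) (z : int) (N : nat) : z != 0 -> (`|z| < N)%N ->
  cos (2 * pi * (z%:~R / N%:R)) != 1 :> R.
Proof.
move=> z0 zN; have N0 : (0 : R) < N%:R by rewrite ltr0n; apply: leq_ltn_trans zN.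
have zp : (0 : R) < `|z|%N%:R by rewrite ltr0n absz_gt0.
have zl : (`|z|%N%:R : R) < N%:R by rewrite ltr_nat.
have s0 : 0 < sin (pi * (`|z|%N%:R / N%:R)) :> R.
  apply: sin_gt0_pi; have := pi_gt0 R => p0; apply/andP; split.
    by rewrite mulr_gt0 // divr_gt0.
  by rewrite gtr_pMr // ltr_pdivrMr // mul1r.
have -> : cos (2 * pi * (z%:~R / N%:R)) = 1 - 2 * sin (pi * (`|z|%N%:R / N%:R)) ^+ 2 :> R.
  rewrite (_ : 2 * pi * _ = (pi * (z%:~R / N%:R)) *+ 2); last by rewrite -mulr_natr; ring.
  rewrite cos_mulr2n natr_absz intr_norm.
  have -> : sin (pi * (`|z%:~R| / N%:R)) ^+ 2 = sin (pi * (z%:~R / N%:R)) ^+ 2 :> R.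
    by have [_|_] := ger0P (z%:~R : R) => //; rewrite mulNr mulrN sinN sqrrN.
  by rewrite [in RHS]sin2cos2; ring.
by apply/eqP => h; have := exprn_gt0 2 s0; lra.
Qed.

Section Inversion.
Variables (R : realType) (m n t : nat) (A : 'M[bool]_(m, n)) (y : 'I_m -> int) (s : int).
Implicit Types (b : {ffun 'I_n -> bool}) (al : 'I_m -> R) (be : R).

Definition rowsum b (i : 'I_m) : int := \sum_j (-1) ^+ b j * (A i j : nat)%:Z.

Definition signsum b : int := \sum_j (-1) ^+ b j.

(** Half of the coordinates [rowsum b i - y i] and [signsum b - s] are integers
    under the parity hypotheses below, so that [pi * phase] is 2 pi times an
    integral linear form in [al] and [be]. *)
Definition phase al be b : R :=
  \sum_i al i * (rowsum b i - y i)%:~R + be * (signsum b - s)%:~R.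

Lemma sum_cos_phase al be :
  \sum_b cos (pi * phase al be b) =
  2 ^+ n * (cos (pi * (\sum_i al i * (y i)%:~R + be * s%:~R)) *
            \prod_j cos (pi * (be + lin al (col j A)))).
Proof.
rewrite -[X in _ * (X * _)]cosN -sum_cos_signs; apply: eq_bigr => b _; congr cos.
rewrite /phase; set L := \sum_i al i * (y i)%:~R.
have -> : \sum_i al i * (rowsum b i - y i)%:~R =
    \sum_j (-1) ^+ b j * lin al (col j A) - L.
  rewrite /L; under eq_bigr do rewrite rmorphB mulrBr.
  rewrite sumrB; congr (_ - _).
  under [RHS]eq_bigr do rewrite /lin mulr_sumr.
  rewrite exchange_big; apply: eq_bigr => i _; rewrite rmorph_sum mulr_sumr.
  by apply: eq_bigr => j _; rewrite mxE rmorphM rmorphXn rmorphN1 mulrCA.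
rewrite rmorphB rmorph_sum /=.
have -> : \sum_(i < n) ((-1) ^+ b i)%:~R = \sum_j (-1) ^+ b j :> R.
  by apply: eq_bigr => j _; rewrite rmorphXn rmorphN1.
have -> : \sum_j (-1) ^+ b j * (pi * (be + lin al (col j A))) =
    pi * (be * \sum_j (-1) ^+ b j + \sum_j (-1) ^+ b j * lin al (col j A)).
  by rewrite mulr_sumr -big_split mulr_sumr; apply: eq_bigr => j _ /=; ring.
ring.
Qed.

Hypotheses (t0 : (0 < t)%N) (tm : (t < m)%N).
Hypotheses (A_sparse : forall j, col j A \in sparse_vectors m t).
Hypotheses (y_sum : \sum_i y i = t%:Z * s).
Hypotheses (y_le : forall i, `|y i| <= 2) (s_le : `|s| <= 1).
Hypotheses (y_par : forall i, exists z, \sum_j (A i j : nat)%:Z - y i = 2 * z)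
           (s_par : exists z, n%:Z - s = 2 * z).

Lemma sum_rowsum b : \sum_i rowsum b i = t%:Z * signsum b.
Proof.
rewrite exchange_big /signsum mulr_sumr; apply: eq_bigr => j _.
rewrite -mulr_sumr mulrC; congr (_ * _).
rewrite -(sparse_sumn (A_sparse j)) (big_morph Posz PoszD (erefl 0%:Z)).
by apply: eq_bigr => i _; rewrite mxE.
Qed.

Lemma signE (c : bool) : (-1) ^+ c = 1 - 2 * (c : nat)%:Z :> int.
Proof. by case: c. Qed.

Lemma rowsum_par b i : exists z, rowsum b i - y i = 2 * z.
Proof.
have [z zE] := y_par i; exists (z - \sum_j (b j : nat)%:Z * (A i j : nat)%:Z).
rewrite mulrBr -zE addrAC; congr (_ - _).
by rewrite mulr_sumr -sumrB; apply: eq_bigr => j _; rewrite signE; ring.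
Qed.

Lemma signsum_par b : exists z, signsum b - s = 2 * z.
Proof.
have [z zE] := s_par; exists (z - \sum_j (b j : nat)%:Z).
rewrite mulrBr -zE addrAC; congr (_ - _).
rewrite mulr_sumr /signsum (eq_bigr _ (fun j _ => signE (b j))) sumrB.
by congr (_ - _); rewrite sumr_const card_ord natz.
Qed.

(** Integer shifts of the frequencies move the angle by multiples of 2 pi.  The
    shift by [rho] has no effect since the coordinates of [rowsum b - y] add up to
    [t * (signsum b - s)]. *)
Lemma cos_phase_gauge al be (u : 'I_m -> R) (ka rho : R) (k : 'I_m -> int) (l : int) b :
  (forall i, al i = rho + u i + (k i)%:~R) -> be = ka - t%:R * rho + l%:~R ->
  cos (pi * phase al be b) = cos (pi * phase u ka b).
Proof.
move=> alE beE.
have [z zE] := choice (rowsum_par b); have [w wE] := signsum_par b.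
rewrite -(cosD2pi_int (pi * phase u ka b) (\sum_i k i * z i + l * w)); congr cos.
have e : rho * (\sum_i (rowsum b i - y i)%:~R - t%:R * (signsum b - s)%:~R) = 0.
  rewrite -rmorph_sum sumrB sum_rowsum y_sum -mulrBr rmorphM /=.
  by rewrite -pmulrn subrr mulr0.
have kz : \sum_i (k i)%:~R * (rowsum b i - y i)%:~R = 2 * (\sum_i k i * z i)%:~R :> R.
  rewrite rmorph_sum mulr_sumr; apply: eq_bigr => i _.
  by rewrite zE !intrM; ring.
rewrite /phase.
have -> : \sum_i al i * (rowsum b i - y i)%:~R =
   rho * \sum_i (rowsum b i - y i)%:~R + \sum_i u i * (rowsum b i - y i)%:~R
   + \sum_i (k i)%:~R * (rowsum b i - y i)%:~R.
  by rewrite mulr_sumr -!big_split; apply: eq_bigr => i _ /=; rewrite alE; ring.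
rewrite kz beE [(_ + l * w)%:~R]intrD [(l * w)%:~R]intrM.
have wR : (signsum b - s)%:~R = 2 * w%:~R :> R by rewrite wE intrM.
rewrite mulrBr wR in e; move/subr0_eq: e => ->; rewrite wR.
set X := \sum_i u i * _; set K := (\sum_i k i * z i)%:~R.
move: X K (w%:~R : R) (l%:~R : R) => X K w' l'; ring.
Qed.

(** After the change of frequencies given by [small_lift], every factor of the
    product formula [sum_cos_phase] is the cosine of an angle of absolute value
    at most pi / 2. *)
Lemma near_sum_ge0 al be :
  m%:R ^+ 2 * mean (sparse_vectors m t) (fun x => sin (pi * (be + lin al x)) ^+ 2) <= 1 / 1024 ->
  0 <= \sum_b cos (pi * phase al be b).
Proof.
move=> Qs; have [u [ka [rho [k [l [alE beE wle kale uQ]]]]]] := small_lift t0 tm Qs.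
rewrite (eq_bigr _ (fun b _ => cos_phase_gauge b alE beE)) sum_cos_phase.
have cos0 (w : R) : `|w| <= 1 / 2 -> 0 <= cos (pi * w).
  rewrite ler_norml => /andP[w1 w2]; apply: cos_ge0_pihalf.
  by have := pi_gt0 R; move=> p0; apply/andP; split; nra.
rewrite mulr_ge0 ?exprn_ge0 // mulr_ge0 //; last first.
  by apply: prodr_ge0 => j _; apply: cos0; exact: wle.
apply: cos0.
have M0 : (0 : R) < m%:R by rewrite ltr0n; apply: leq_ltn_trans tm.
have a1 := spread_ge R t0 tm.
set Q := mean _ _ in Qs uQ; set U := \sum_i u i ^+ 2 in uQ.
have Q0 : 0 <= Q by apply: mean_ge0 => x _; exact: sqr_ge0.
have U0 : 0 <= U by apply: sumr_ge0 => i _; exact: sqr_ge0.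
have y2 : \sum_i ((y i)%:~R : R) ^+ 2 <= 4 * m%:R.
  apply: (@le_trans _ _ (\sum_(i < m) (4 : R))).
    apply: ler_sum => i _.
    have : `|(y i)%:~R : R| <= 2 by rewrite -intr_norm (ler_int _ _ 2).
    rewrite -(real_normK (num_real ((y i)%:~R : R))); have := normr_ge0 ((y i)%:~R : R); nra.
  by rewrite sumr_const card_ord -[leLHS]mulr_natr.
(* Here the sharp bound on [sum u_i^2] is used: the weak one would lose a
   factor [m]. *)
have uy : (\sum_i u i * (y i)%:~R) ^+ 2 <= 4 * (m%:R ^+ 2 * Q).
  apply: le_trans (cauchy_schwarz_sum _ _) _; rewrite -/U.
  apply: (@le_trans _ _ (U * (4 * m%:R))); first by rewrite ler_wpM2l.
  have : U <= m%:R * Q.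
    apply: (@le_trans _ _ (m%:R * spread R m t * U)); first by rewrite ler_peMl.
    by rewrite -mulrA ler_pM2l.
  nra.
have kas : `|ka * s%:~R| <= 1 / 3.
  rewrite normrM -intr_norm; have : (`|s|%:~R : R) <= 1 by rewrite (ler_int _ _ 1).
  have : (0 : R) <= `|s|%:~R by rewrite ler0z.
  have := normr_ge0 ka; nra.
apply: le_trans (ler_normD _ _) _.
have : `|\sum_i u i * (y i)%:~R| <= 1 / 6.
  by rewrite -(@ler_pXn2r _ 2) ?nnegrE ?normr_ge0 // real_normK ?num_real //; lra.
lra.
Qed.

(** The frequencies al in ((1/n)Z / Z)^m and be in (1/n)Z / Z.  Modulus [n] is
    large enough to recognize equality, as the integers to be compared differ by
    at most (n + 2) / 2 < n. *)
Definition grid_lin (p : {ffun 'I_m -> 'I_n} * 'I_n) (i : 'I_m) : R := (p.1 i)%:R / n%:R.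
Definition grid_cst (p : {ffun 'I_m -> 'I_n} * 'I_n) : R := p.2%:R / n%:R.

Definition far (p : {ffun 'I_m -> 'I_n} * 'I_n) : bool :=
  1 / 1024 < m%:R ^+ 2 *
    mean (sparse_vectors m t) (fun x => sin (pi * (grid_cst p + lin (grid_lin p) x)) ^+ 2).

Definition far_sum : R :=
  \sum_(p | far p) \prod_j `|cos (pi * (grid_cst p + lin (grid_lin p) (col j A)))|.

(** The integer [k] accounts for the wrap-around of the cyclic successor. *)
Lemma ordS_frac (i : 'I_n) : exists k : int,
  (ordS i)%:R / n%:R = i%:R / n%:R + 1 / n%:R + k%:~R :> R.
Proof.
have n0 : (n%:R : R) != 0 by rewrite pnatr_eq0; case: i => [i /= il]; lia.
exists (- (i.+1 %/ n)%:Z).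
have : (i.+1%:R : R) = (i.+1 %/ n)%:R * n%:R + (ordS i)%:R.
  by rewrite -natrM -natrD {1}(divn_eq i.+1 n).
rewrite -natr1 mulrNz -pmulrn => h.
apply: (mulIf n0); rewrite mulrDl mulrDl !divfK //; move: h; lra.
Qed.

(** The sum over the grid of the product formula is positive: the zero
    frequency gives 2^n, near frequencies give nonnegative terms, and the others
    give at most [2^n * far_sum] in absolute value.  So some sign vector [b] has a
    positive sum of cosines over the grid, which by [sum_cos_shift] would vanish
    if some coordinate of [rowsum b - y] were nonzero. *)
Lemma exists_signs : (3 <= n)%N ->
  far_sum < 1 ->
  exists b, forall i, rowsum b i = y i.
Proof.
move=> n3 farlt.
have n0 : (n%:R : R) != 0 by rewrite pnatr_eq0; lia.
pose W p := \sum_b cos (pi * phase (grid_lin p) (grid_cst p) b).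
pose p0 : {ffun 'I_m -> 'I_n} * 'I_n :=
  ([ffun=> Ordinal (ltnW (ltnW n3))], Ordinal (ltnW (ltnW n3))).
have al0 i : grid_lin p0 i = 0 by rewrite /grid_lin ffunE mul0r.
have be0 : grid_cst p0 = 0 by rewrite /grid_cst mul0r.
have W0 : W p0 = 2 ^+ n.
  rewrite /W (eq_bigr (fun=> 1)) => [|b _].
    by rewrite sumr_const card_ffun card_bool card_ord natrX.
  rewrite /phase be0 mul0r addr0 big1 ?mulr0 ?cos0 // => i _.
  by rewrite al0 mul0r.
have p0near : ~~ far p0.
  have e : mean (sparse_vectors m t)
      (fun x => sin (pi * (grid_cst p0 + lin (grid_lin p0) x)) ^+ 2) = 0.
    rewrite -[RHS](mean_cst (card_sparse_gt0 tm)); apply: eq_mean => x _.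
    rewrite be0 add0r /lin big1 ?mulr0 ?sin0 ?expr0n // => i _.
    by rewrite al0 mul0r.
  by rewrite /far e mulr0 -leNgt; lra.
have Wpos : 0 < \sum_p W p.
  rewrite (bigID far) /= [X in _ + X](bigD1 p0) //= W0.
  have h1 : 0 <= \sum_(p | ~~ far p && (p != p0)) W p.
    apply: sumr_ge0 => p /andP[]; rewrite /far -leNgt => h _; exact: near_sum_ge0 h.
  have h2 : - (2 ^+ n * far_sum) <= \sum_(p | far p) W p.
    rewrite mulr_sumr -sumrN; apply: ler_sum => p _.
    rewrite /W sum_cos_phase lerNl -mulrN ler_pM2l ?exprn_gt0 //.
    apply: le_trans (ler_norm _) _; rewrite normrN normrM -normr_prod.
    by rewrite ler_piMl ?normr_ge0 ?cos_max.
  have p2 : 0 < (2 : R) ^+ n by rewrite exprn_gt0.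
  by move: h1 h2 farlt; nra.
have [b bpos] : exists b, 0 < \sum_p cos (pi * phase (grid_lin p) (grid_cst p) b).
  move: Wpos; rewrite /W exchange_big /= => Wpos; apply/not_existsP => h.
  by move: Wpos; rewrite ltNge => /negP; apply; apply: sumr_le0 => b _; rewrite leNgt; apply/negP.
exists b => i0; apply/eqP; rewrite -subr_eq0; apply/negPn/negP => d0.
have [z zE] := rowsum_par b i0.
have z0 : z != 0 by apply: contraNneq d0 => z0; rewrite zE z0 mulr0.
have zn : (`|z| < n)%N.
  have rle : `|rowsum b i0| <= n%:Z.
    apply: le_trans (ler_norm_sum _ _ _) _.
    apply: (@le_trans _ _ (\sum_(j < n) (1 : int))); last by rewrite sumr_const card_ord natz.
    by apply: ler_sum => j _; rewrite normrM normr_sign mul1r; case: (A i0 j).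
  have := y_le i0; move: rle zE; move: (rowsum b i0) (y i0) (n3) => a c ? ? ?; lia.
suff h : \sum_p cos (pi * phase (grid_lin p) (grid_cst p) b) = 0 by rewrite h ltxx in bpos.
pose sh (p : {ffun 'I_m -> 'I_n} * 'I_n) :=
   ([ffun i => if i == i0 then ordS (p.1 i) else p.1 i], p.2).
apply: (@sum_cos_shift R _ sh _ (2 * pi * (z%:~R / n%:R))); last exact: cos_neq1.
  move=> [p q] [p' q'] [/ffunP /= h ->]; congr (_, _); apply/ffunP => i.
  have := h i; rewrite !ffunE; case: eqP => // _; exact: (bij_inj (ordS_bij n)).
move=> p; have [k kE] := ordS_frac (p.1 i0).
exists (k * z).
rewrite /phase (bigD1 i0) //= [in RHS](bigD1 i0) //=.
have -> : grid_cst (sh p) = grid_cst p by [].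
rewrite (eq_bigr (fun i => grid_lin p i * (rowsum b i - y i)%:~R)) => [|i ii]; last first.
  by rewrite /grid_lin ffunE (negPf ii).
rewrite {1}/grid_lin ffunE eqxx kE zE -/(grid_lin p i0) !intrM.
set X := \sum_(i < m | _) _; set Y := grid_cst p * _.
by move: X Y (grid_lin p i0) (k%:~R : R) (z%:~R : R) => X Y g k' z'; field.
Qed.
End Inversion.

(** * The law of a random sparse matrix *)

Definition column_weight (R : realType) (m t : nat) (x : 'cV[bool]_m) : R :=
  if x \in sparse_vectors m t then #|sparse_vectors m t|%:R^-1 else 0.

(** The probability that a random sparse matrix equals [A]; see
    [Pr_random_sparse]. *)
Definition weight (R : realType) (m n t : nat) (A : 'M[bool]_(m, n)) : R :=
  \prod_j column_weight R t (col j A).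

Lemma Pr_sum (R : realType) (d : measure_display) (T : measurableType d)
    (P : probability T R) (U : finType) (X : T -> U) (E : pred U) :
  random_element X ->
  Pr P [set w | E (X w)] = \sum_(x | E x) Pr P [set w | X w = x].
Proof.
move=> mX; rewrite /Pr.
have -> : [set w | E (X w)] = \bigcup_(x in [set` enum E]) [set w | X w = x].
  apply/seteqP; split => w /=.
    by move=> Ew; exists (X w) => //=; rewrite mem_enum.
  by move=> [x /=]; rewrite mem_enum => Ex ->.
rewrite measure_fin_bigcup //=; last first.
  by move=> x y _ _ [w [/= <- <-]].
rewrite -fsbig_seq ?enum_uniq // big_enum /= sum_fine // => x _.
exact: fin_num_measure.
Qed.

Lemma Pr_random_sparse (R : realType) (d : measure_display) (T : measurableType d)
    (P : probability T R) (m n t : nat) (M : T -> 'M[bool]_(m, n)) (E : pred 'M[bool]_(m, n)) :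
  random_sparse P t M ->
  Pr P [set w | E (M w)] = \sum_(A | E A) weight R t A.
Proof.
move=> [mM indep unif]; rewrite Pr_sum //; apply: eq_bigr => A _.
rewrite /weight; transitivity (Pr P [set w | forall j, col j (M w) \in [set col j A]%SET]).
  congr Pr; apply/seteqP; split => w /=; first by move=> -> j; rewrite finset.inE.
  move=> h; apply/matrixP => i j; have := h j; rewrite finset.inE => /eqP/colP/(_ i).
  by rewrite !mxE.
rewrite indep; apply: eq_bigr => j _; rewrite /column_weight -(unif j).
by congr Pr; apply/seteqP; split => w /=; rewrite finset.inE => /eqP.
Qed.

Lemma sum_weight_prod (R : realType) (m n t : nat) (h : 'cV[bool]_m -> R) :
  \sum_(A : 'M[bool]_(m, n)) weight R t A * \prod_j h (col j A) =
  mean (sparse_vectors m t) h ^+ n.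
Proof.
have -> : mean (sparse_vectors m t) h = \sum_x column_weight R t x * h x.
  rewrite /mean mulr_sumr big_mkcond; apply: eq_bigr => x _; rewrite /column_weight.
  by case: ifP; rewrite ?mul0r.
rewrite -[in RHS](card_ord n) -prodr_const.
rewrite (bigA_distr_bigA (fun (j : 'I_n) x => column_weight R t x * h x)) /=.
pose f (A : 'M[bool]_(m, n)) : {ffun 'I_n -> 'cV[bool]_m} := [ffun j => col j A].
pose g (F : {ffun 'I_n -> 'cV[bool]_m}) : 'M[bool]_(m, n) := \matrix_(i, j) F j i ord0.
have fK : cancel f g by move=> A; apply/matrixP => i j; rewrite mxE ffunE mxE.
have gK : cancel g f.
  by move=> F; apply/ffunP => j; apply/colP => i; rewrite ffunE !mxE.
rewrite [RHS](reindex f) /=; last by exists g => ? _; [exact: fK | exact: gK].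
apply: eq_bigr => A _; rewrite /weight -big_split; apply: eq_bigr => j _.
by rewrite /= ffunE.
Qed.

Lemma weight_ge0 (R : realType) (m n t : nat) (A : 'M[bool]_(m, n)) : 0 <= weight R t A.
Proof. by apply: prodr_ge0 => j _; rewrite /column_weight; case: ifP => // _; rewrite invr_ge0. Qed.

Lemma weight_neq0 (R : realType) (m n t : nat) (A : 'M[bool]_(m, n)) :
  weight R t A != 0 -> forall j, col j A \in sparse_vectors m t.
Proof.
by move=> /prodf_neq0 h j; have := h j isT; rewrite /column_weight; case: ifP; rewrite ?eqxx.
Qed.


(** * The far frequencies of a random sparse matrix *)

Lemma expr_le_expR (R : realType) (x : R) (n : nat) : 0 <= 1 - x ->
  (1 - x) ^+ n <= expR (- (n%:R * x)).
Proof.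
move=> x1; rewrite -mulrN expRM_natl; apply: lerXn2r; rewrite ?nnegrE ?expR_ge0 //.
exact: expR_ge1Dx.
Qed.

(** Markov's inequality for [far_sum], whose mean is at most n^(m+1) times
    exp (- n / (2048 m^2)). *)
Lemma sum_weight_bad (R : realType) (m n t : nat) : (0 < t)%N -> (t < m)%N -> (0 < n)%N ->
  4096 * m%:R ^+ 3 * ln (n%:R : R) <= n%:R ->
  \sum_(A : 'M[bool]_(m, n) | 1 <= far_sum R t A) weight R t A
  <= (n%:R)^-1.
Proof.
move=> t0 tm n0 nbig; pose G (A : 'M[bool]_(m, n)) := far_sum R t A.
have N0 : (0 : R) < n%:R by rewrite ltr0n.
have M2 : (2 : R) <= m%:R by rewrite ler_nat; apply: leq_trans tm.
apply: (@le_trans _ _ (\sum_A weight R t A * G A)).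
  rewrite [leLHS]big_mkcond; apply: ler_sum => A _.
  have G0 : 0 <= G A by apply: sumr_ge0 => p _; apply: prodr_ge0 => j _; exact: normr_ge0.
  have w0 := weight_ge0 R t A.
  by case: ifP => [G1|_]; [rewrite ler_peMr | rewrite mulr_ge0].
under eq_bigr => A _ do rewrite mulr_sumr.
rewrite exchange_big /=.
pose e : R := expR (- (n%:R / (2048 * m%:R ^+ 2))).
apply: (@le_trans _ _ (\sum_(p : {ffun 'I_m -> 'I_n} * 'I_n | far R t p) e)).
  apply: ler_sum => p pfar.
  rewrite (sum_weight_prod _ _ (fun x => `|cos (pi * (grid_cst R p + lin (grid_lin R p) x))|)).
  pose Q := mean (sparse_vectors m t)
    (fun x => sin (pi * (grid_cst R p + lin (grid_lin R p) x)) ^+ 2).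
  have pf : 1 / 1024 < m%:R ^+ 2 * Q := pfar.
  have Q1 : Q <= 1.
    rewrite -[leRHS](mean_cst (card_sparse_gt0 tm)); apply: le_mean => x _.
    by rewrite sin2cos2; have := sqr_ge0 (cos (pi * (grid_cst R p + lin (grid_lin R p) x))); lra.
  have cosQ : mean (sparse_vectors m t)
      (fun x => `|cos (pi * (grid_cst R p + lin (grid_lin R p) x))|) <= 1 - Q / 2.
    apply: (@le_trans _ _ (mean (sparse_vectors m t)
      (fun x => 1 + (- 2^-1) * sin (pi * (grid_cst R p + lin (grid_lin R p) x)) ^+ 2))).
      by apply: le_mean => x _; rewrite mulNr (mulrC 2^-1); exact: norm_cos_le.
    by rewrite meanD meanZ mean_cst ?card_sparse_gt0 // -/Q; lra.
  apply: le_trans (lerXn2r n _ _ cosQ) _; rewrite ?nnegrE.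
  - by apply: mean_ge0 => x _; exact: normr_ge0.
  - lra.
  apply: le_trans (expr_le_expR n _) _; first lra.
  rewrite ler_expR lerN2 ler_wpM2l ?ltW //.
  rewrite -[ltLHS]div1r ltr_pdivrMr; last first.
    have : (0 : R) < m%:R ^+ 2 by rewrite exprn_gt0; lra.
    by lra.
  rewrite (_ : Q / 2 * _ = 1024 * (m%:R ^+ 2 * Q)); last by field.
  by lra.
rewrite sumr_const -[leLHS]mulr_natl.
apply: (@le_trans _ _ (n%:R ^+ m.+1 * e)).
  rewrite ler_wpM2r ?expR_ge0 // -(natrX R n m.+1) ler_nat.
  apply: leq_trans (max_card _) _.
  by rewrite card_prod card_ffun !card_ord expnSr.
have nE : expR (ln n%:R) = n%:R :> R by rewrite lnK ?posrE.
rewrite -[X in X ^+ _]nE -expRM_natr -expRD -[X in _ <= X^-1]nE -expRN ler_expR.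
set L := ln _ in nbig *.
have h : (2 * m%:R) * L <= n%:R / (2048 * m%:R ^+ 2).
  rewrite ler_pdivlMr; last by nra.
  by apply: le_trans nbig; rewrite le_eqVlt; apply/orP; left; apply/eqP; ring.
have L0 : 0 <= L by apply: ln_ge0; rewrite ler1n.
rewrite -natr1; nra.
Qed.

(** * Parities of the row sums *)

Definition parity_char (R : realType) (m : nat) (B : {set 'I_m}) (x : 'cV[bool]_m) : R :=
  \prod_(i in B) (-1) ^+ x i ord0.

Lemma cos_pi_nat (R : realType) (k : nat) : cos (pi * k%:R) = (-1) ^+ k :> R.
Proof.
by rewrite mulr_natr -[X in cos X]add0r (alternatingn (@cosDpi R)) cos0 mulr1.
Qed.

(** The character of [B] is cos (2 pi <u, x>) with [u] equal to 1/2 on [B] and 0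
    elsewhere, so [swap_bound] applies to [i] in [B] and [j] outside [B].  With
    [be = 0] it bounds the mean from above, with [be = 1/2] from below. *)
Lemma norm_mean_parity_char (R : realType) (m t : nat) (B : {set 'I_m}) :
  (0 < t)%N -> (t < m)%N -> B != finset.set0 -> B != finset.setT ->
  `|mean (sparse_vectors m t) (@parity_char R m B)| <= 1 - m%:R^-1.
Proof.
move=> t0 tm /set0Pn[i iB] BT.
have [j jB] : exists j, j \notin B.
  by apply/existsP; rewrite -negb_forall; apply: contra BT => /forallP h; apply/eqP/setP => j;
     rewrite finset.inE h.
have ij : i != j by apply: contraNneq jB => <-.
pose u k : R := (k \in B)%:R / 2.
have charE x : parity_char R B x = cos (2 * (pi * lin u x)).
  rewrite /parity_char prodrXr -cos_pi_nat; congr cos; rewrite mulrCA; congr (_ * _).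
  rewrite natr_sum big_mkcond mulr_sumr; apply: eq_bigr => k _; rewrite /u.
  by case: (k \in B) => /=; field.
have cos2 (y : R) : cos (2 * y) = 1 - 2 * sin y ^+ 2.
  by rewrite mulr_natl cos_mulr2n cos2sin2 mulr2n; ring.
have cos2' (y : R) : cos (2 * y) = - 1 + 2 * sin (y + pi / 2) ^+ 2.
  by rewrite sinDpihalf mulr_natl cos_mulr2n mulr2n; ring.
have M0 : (0 : R) < m%:R by rewrite ltr0n; apply: leq_ltn_trans tm.
have sij : sin (pi * (u i - u j)) ^+ 2 = 1.
  by rewrite /u iB (negPf jB) mul0r subr0 mul1r sin_pihalf expr1n.
have sp : m%:R^-1 / 2 <= spread R m t / 2.
  rewrite ler_wpM2r // -(ler_pM2l M0) divff ?gt_eqF //; exact: spread_ge.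
have b0 := swap_bound t0 tm 0 u ij; rewrite sij mulr1 in b0.
have b1 := swap_bound t0 tm (1 / 2) u ij; rewrite sij mulr1 in b1.
have S0 := card_sparse_gt0 tm.
rewrite ler_norml; apply/andP; split.
  rewrite (eq_mean (h2 := fun x => - 1 + 2 * sin (pi * (1 / 2 + lin u x)) ^+ 2)).
    by rewrite meanD meanZ mean_cst //; lra.
  by move=> x _; rewrite charE cos2'; congr (_ + _ * sin _ ^+ _); ring.
rewrite (eq_mean (h2 := fun x => 1 + - 2 * sin (pi * (0 + lin u x)) ^+ 2)).
  by rewrite meanD meanZ mean_cst //; lra.
by move=> x _; rewrite charE cos2 add0r mulNr.
Qed.

Definition odd_rows (m n : nat) (A : 'M[bool]_(m, n)) : {set 'I_m} :=
  [set i | odd (\sum_j A i j)]%SET.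

(** Fourier inversion on (Z/2)^m, written as the expansion of the product over
    the rows of (1 + f i) / 2, where [f i = 1] exactly when row [i] has the
    prescribed parity and [f i = -1] otherwise. *)
Lemma odd_rows_indicator (R : realType) (m n : nat) (A : 'M[bool]_(m, n)) (s : {set 'I_m}) :
  (odd_rows A == s)%:R = 2 ^- m * \sum_(B : {set 'I_m})
    \prod_(i in B) (-1) ^+ (i \in s) * \prod_j parity_char R B (col j A).
Proof.
pose f i : R := (-1) ^+ (i \in s) * (-1) ^+ (i \in odd_rows A).
have fE (B : {set 'I_m}) : \prod_(i in B) (-1) ^+ (i \in s) * \prod_j parity_char R B (col j A)
    = \prod_i (if i \in B then f i else 1).
  rewrite /parity_char exchange_big -big_mkcond -big_split /=; apply: eq_bigr => i _.
  rewrite /f finset.inE signr_odd -prodrXr; congr (_ * _).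
  by apply: eq_bigr => j _; rewrite mxE.
rewrite (eq_bigr _ (fun B _ => fE B)) -(bigA_distr 1 +%R) /=.
have [es|/eqP ne] := eqVneq (odd_rows A) s.
  rewrite (eq_bigr (fun=> 2)) => [|i _].
    by rewrite prodr_const card_ord mulVf // expf_neq0 // pnatr_eq0.
  by rewrite /f es -expr2 sqrr_sign.
have [i] : exists i, (i \in s) != (i \in odd_rows A).
  apply/existsP; rewrite -negb_forall; apply/negP => /forallP h; apply: ne.
  by apply/setP => i; apply/esym/eqP.
move=> hi; rewrite (bigD1 i) //= /f.
by case: (i \in s) (i \in odd_rows A) hi => [] [] // _;
  rewrite expr0 expr1 ?mul1r ?mulr1 addNr mul0r mulr0.
Qed.

(** The empty set and the full set give the main term, as their characters are
    constant on sparse vectors; the full one reflects that all the entries of the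
    matrix add up to [t * n]. *)
Lemma sum_weight_odd_rows (R : realType) (m n t : nat) (s : {set 'I_m}) :
  (0 < t)%N -> (t < m)%N ->
  `|\sum_(A : 'M[bool]_(m, n) | odd_rows A == s) weight R t A
    - 2 ^- m * (1 + (-1) ^+ (#|s| + t * n))| <= expR (- (n%:R / m%:R)).
Proof.
move=> t0 tm; have S0 := card_sparse_gt0 tm.
have M0 : (0 : R) < m%:R by rewrite ltr0n; apply: leq_ltn_trans tm.
have M1 : (1 : R) <= m%:R by rewrite ler1n; apply: leq_ltn_trans tm.
pose g (B : {set 'I_m}) : R := \prod_(i in B) (-1) ^+ (i \in s) *
   mean (sparse_vectors m t) (@parity_char R m B) ^+ n.
have -> : \sum_(A : 'M[bool]_(m, n) | odd_rows A == s) weight R t A = 2 ^- m * \sum_B g B.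
  transitivity (\sum_(A : 'M[bool]_(m, n)) weight R t A * (odd_rows A == s)%:R).
    by rewrite big_mkcond; apply: eq_bigr => A _; case: eqP; rewrite ?mulr1 ?mulr0.
  under eq_bigr => A _ do rewrite odd_rows_indicator mulrCA mulr_sumr.
  rewrite -mulr_sumr exchange_big; congr (_ * _); apply: eq_bigr => B _.
  rewrite /g -sum_weight_prod mulr_sumr; apply: eq_bigr => A _; exact: mulrCA.
have T0 : [set: 'I_m]%SET != finset.set0.
  by apply/set0Pn; exists (Ordinal (leq_ltn_trans (leq0n t) tm)); rewrite finset.inE.
rewrite (bigD1 finset.set0) //= (bigD1 [set: 'I_m]%SET) //=.
have -> : g finset.set0 = 1.
  rewrite /g big_set0 mul1r (eq_mean (h2 := fun=> 1)) ?mean_cst ?expr1n // => x _.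
  by rewrite /parity_char big_set0.
have -> : g [set: 'I_m]%SET = (-1) ^+ (#|s| + t * n).
  rewrite /g exprD exprM; congr (_ * _ ^+ _).
    rewrite prodrXr; congr (_ ^+ _); rewrite -sum1_card [RHS]big_mkcond /=.
    by apply: eq_big => [i|i _]; [rewrite finset.inE | case: (i \in s)].
  rewrite (eq_mean (h2 := fun=> (-1) ^+ t)) ?mean_cst // => x xS.
  rewrite /parity_char prodrXr -[in RHS](sparse_sumn xS); congr (_ ^+ _).
  by apply: eq_bigl => i; rewrite finset.inE.
set rest := \sum_(B | _) _.
rewrite (_ : _ - _ = 2 ^- m * rest); last by ring.
rewrite normrM ger0_norm ?invr_ge0 ?exprn_ge0 //.
have p2 : 0 < (2 : R) ^+ m by rewrite exprn_gt0.
rewrite mulrC ler_pdivrMr // mulrC.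
apply: le_trans (ler_norm_sum _ _ _) _.
apply: (@le_trans _ _ (\sum_(B : {set 'I_m}) expR (- (n%:R / m%:R)) : R)); last first.
  by rewrite sumr_const -cardsT -powersetT card_powerset cardsT card_ord -[leLHS]mulr_natl natrX.
rewrite big_mkcond; apply: ler_sum => B _; case: ifP => [/andP[B0 BT]|_]; last exact: expR_ge0.
rewrite /g normrM prodrXr normrX normrN1 expr1n mul1r normrX.
apply: le_trans (lerXn2r n _ _ (norm_mean_parity_char R t0 tm B0 BT)) _.
- by rewrite nnegrE.
- by rewrite nnegrE subr_ge0 invf_le1.
by apply: expr_le_expR; rewrite subr_ge0 invf_le1.
Qed.

(** * Discrepancy as a function of the odd rows *)

Lemma mx_norm_le (R : realType) (m : nat) (v : 'cV[R]_m) (k : R) :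
  0 <= k -> (forall i, `|v i ord0| <= k) -> `|v| <= k.
Proof.
move=> k0 h; rewrite /Num.norm /= mx_normrE; apply: bigmax_le => // -[i j] _ /=.
by rewrite (ord1 j).
Qed.

Lemma le_mx_norm (R : realType) (m : nat) (v : 'cV[R]_m) (i : 'I_m) : `|v i ord0| <= `|v|.
Proof.
rewrite [leRHS]/Num.norm /= mx_normrE.
exact: (le_bigmax _ (fun ij : 'I_m * 'I_1 => `|v ij.1 ij.2|) (i, ord0)).
Qed.

Lemma real_mx_signs (R : realType) (m n : nat) (A : 'M[bool]_(m, n)) (b : {ffun 'I_n -> bool}) i :
  (real_mx R A *m signs R b) i ord0 = (rowsum A b i)%:~R.
Proof.
rewrite mxE /rowsum rmorph_sum; apply: eq_bigr => j _.
by rewrite !mxE rmorphM rmorphXn rmorphN1 mulrC.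
Qed.

Lemma disc_le (R : realType) (m n : nat) (A : 'M[bool]_(m, n)) (b : {ffun 'I_n -> bool}) (k : nat) :
  (forall i, `|rowsum A b i| <= k%:Z) -> disc (real_mx R A) <= k%:R.
Proof.
move=> h; apply: le_trans (mx_norm_le (v := real_mx R A *m signs R b) _ _); last 2 first.
- exact: ler0n.
- by move=> i; rewrite real_mx_signs -intr_norm pmulrn ler_int.
by apply: (disc_min _).2; apply/signsP; exists b.
Qed.

Lemma disc_ge (R : realType) (m n : nat) (A : 'M[bool]_(m, n)) (k : nat) :
  (forall b, exists i, k%:Z <= `|rowsum A b i|) -> k%:R <= disc (real_mx R A).
Proof.
move=> h; have [[v /signsP[b ->] ->] _] := disc_min (real_mx R A).
have [i ki] := h b; apply: le_trans (le_mx_norm _ i).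
by rewrite real_mx_signs -intr_norm pmulrn ler_int.
Qed.

Lemma disc_ge0 (R : realType) (m n : nat) (A : 'M[bool]_(m, n)) : 0 <= disc (real_mx R A).
Proof. by have [[v _ ->] _] := disc_min (real_mx R A); exact: normr_ge0. Qed.

Lemma subset_of_card (T : finType) (S : {set T}) (k : nat) : (k <= #|S|)%N ->
  exists2 B : {set T}, B \subset S & #|B| = k.
Proof.
move=> kS; exists [set x in take k (enum S)]%SET.
  by apply/fintype.subsetP => x; rewrite finset.inE => /mem_take; rewrite mem_enum.
rewrite cardsE (card_uniqP (take_uniq _ (enum_uniq _))) size_take -cardE.
by case: ltngtP kS => // ->.
Qed.

Section Disc.
Variables (R : realType) (m n t : nat) (A : 'M[bool]_(m, n)).
Hypotheses (t0 : (0 < t)%N) (tm : (t < m)%N) (n3 : (3 <= n)%N).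
Hypothesis (A_sparse : forall j, col j A \in sparse_vectors m t).
Implicit Types b : {ffun 'I_n -> bool}.

Local Notation s := (odd_rows A).

Lemma row_oddE i : \sum_j (A i j : nat)%:Z = (i \in s : nat)%:Z + 2 * ((\sum_j A i j)./2)%:Z.
Proof.
rewrite finset.inE -(big_morph Posz PoszD (erefl 0%:Z)).
by have := odd_double_half (\sum_j A i j); lia.
Qed.

Lemma rowsum_oddE b i : exists z, rowsum A b i = (i \in s : nat)%:Z + 2 * z.
Proof.
exists (((\sum_j A i j)./2)%:Z - \sum_j (b j : nat)%:Z * (A i j : nat)%:Z).
rewrite mulrBr addrA -row_oddE mulr_sumr -sumrB; apply: eq_bigr => j _.
by rewrite signE; ring.
Qed.

Lemma signsum_oddE b : exists z, signsum b = (odd n : nat)%:Z + 2 * z.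
Proof.
exists ((n./2)%:Z - \sum_j (b j : nat)%:Z).
rewrite /signsum (eq_bigr _ (fun j _ => signE (b j))) sumrB -mulr_sumr.
have -> : \sum_(j < n) 1 = n%:Z by rewrite sumr_const card_ord natz.
by rewrite mulrBr addrA; congr (_ - _); have := odd_double_half n; lia.
Qed.

Lemma odd_card_odd_rows : odd #|s| = odd (t * n).
Proof.
have -> : (t * n = \sum_i \sum_j A i j)%N.
  rewrite exchange_big mulnC -[X in (X * _)%N](card_ord n) -sum_nat_const.
  apply: eq_bigr => j _; rewrite -(sparse_sumn (A_sparse j)).
  by apply: eq_bigr => i _; rewrite mxE.
rewrite -sum1_card big_mkcond /=.
rewrite (big_morph odd oddD (erefl _)) [RHS](big_morph odd oddD (erefl _)).
have oddb (c : bool) : odd (if c then 1%N else 0%N) = c by case: c.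
by apply: eq_bigr => i _; rewrite finset.inE oddb.
Qed.

Lemma sum_mem (B : {set 'I_m}) : \sum_i (i \in B : nat)%:Z = #|B|%:Z.
Proof.
rewrite -sum1_card -(big_morph Posz PoszD (erefl 0%:Z)); congr Posz.
by rewrite [RHS]big_mkcond.
Qed.

Lemma norm_sum_rowsum b : odd n -> t%:Z <= `|\sum_i rowsum A b i|.
Proof using t0 tm n3 A_sparse.
move=> on; rewrite (sum_rowsum A_sparse b); have [z ->] := signsum_oddE b; rewrite on.
rewrite normrM ger0_norm // ler_peMr //; lia.
Qed.

Lemma disc_odd_ge1 : odd n -> 1 <= disc (real_mx R A).
Proof using t0 tm n3 A_sparse.
move=> on; apply: (@disc_ge _ _ _ A 1) => b; apply/not_existsP => h.
have := norm_sum_rowsum b on; rewrite big1 ?normr0 => [|i _]; first by move: t0; lia.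
by apply/eqP; rewrite -normr_le0; have /negP := h i; rewrite -ltNge; lia.
Qed.

(** If no entry of [A v] exceeds 1 in absolute value, only the odd rows
    contribute to the sum of the entries, which is a nonzero multiple of [t]. *)
Lemma disc_odd_ge2 : odd n -> (#|s| < t)%N -> 2 <= disc (real_mx R A).
Proof using t0 tm n3 A_sparse.
move=> on st; apply: disc_ge => b; apply/not_existsP => h.
have := norm_sum_rowsum b on; apply/negP; rewrite -ltNge.
apply: le_lt_trans (ler_norm_sum _ _ _) _.
apply: (@le_lt_trans _ _ (\sum_i (i \in s : nat)%:Z)); last by rewrite sum_mem.
apply: ler_sum => i _; have /negP := h i; rewrite -ltNge.
by have [z ->] := rowsum_oddE b i; case: (i \in s); lia.
Qed.

Hypothesis good : far_sum R t A < 1.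

Lemma exists_rowsum (y : 'I_m -> int) (sg : int) :
  \sum_i y i = t%:Z * sg -> (forall i, `|y i| <= 2) -> `|sg| <= 1 ->
  (forall i, exists z, y i = (i \in s : nat)%:Z + 2 * z) ->
  (exists z, sg = (odd n : nat)%:Z + 2 * z) ->
  exists b, forall i, rowsum A b i = y i.
Proof.
move=> ysum y2 sg1 ypar sgpar; apply: (exists_signs (R := R) (s := sg) t0 tm) => //.
- move=> i; have [z ->] := ypar i; rewrite row_oddE.
  by exists ((\sum_j A i j)./2%:Z - z); ring.
- have [z ->] := sgpar; exists (n./2%:Z - z).
  by have := odd_double_half n; lia.
Qed.

(** The target is 1 on [B] and -1 on the other odd rows. *)
Lemma exists_rowsum1 (B : {set 'I_m}) (sg : nat) : B \subset s ->
  (#|B|.*2 = #|s| + t * sg)%N -> (sg <= 1)%N -> odd sg = odd n ->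
  exists b, forall i, `|rowsum A b i| <= 1.
Proof.
move=> Bs cB sg1 sgn.
pose y i : int := 2 * (i \in B : nat)%:Z - (i \in s : nat)%:Z.
have y1 i : `|y i| <= 1.
  by rewrite /y; have := fintype.subsetP Bs i; case: (i \in B) (i \in s) => [] [] // /(_ isT).
have [|||||b bE] := @exists_rowsum y sg%:Z.
- by rewrite sumrB -mulr_sumr !sum_mem; lia.
- by move=> i; apply: le_trans (y1 i) _.
- by move: sg1; lia.
- by move=> i; exists ((i \in B : nat)%:Z - (i \in s : nat)%:Z); rewrite /y; ring.
- by exists (sg./2)%:Z; rewrite -sgn; have := odd_double_half sg; lia.
by exists b => i; rewrite bE.
Qed.

Lemma disc_even : ~~ odd n -> disc (real_mx R A) = (s != finset.set0)%:R.
Proof.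
move=> en; have es : ~~ odd #|s| by rewrite odd_card_odd_rows oddM (negPf en) andbF.
have [B Bs cB] : exists2 B : {set 'I_m}, B \subset s & #|B| = #|s|./2.
  by apply: subset_of_card; rewrite leq_half_double; lia.
have [|||b bE] := @exists_rowsum1 B 0 Bs => //.
- by rewrite cB muln0 addn0 even_halfK.
- by rewrite (negPf en).
apply/eqP; rewrite eq_le; apply/andP; split.
  apply: (@disc_le _ _ _ A b) => i; have [s0|_] := eqVneq s finset.set0; last exact: bE.
  have [z zE] := rowsum_oddE b i; have := bE i.
  by rewrite zE s0 finset.inE; lia.
have [s0|/set0Pn[i si]] := eqVneq s finset.set0; first exact: disc_ge0.
apply: disc_ge => b'; exists i; have [z ->] := rowsum_oddE b' i; rewrite si; lia.
Qed.

Lemma disc_odd : odd n -> disc (real_mx R A) = if (t <= #|s|)%N then 1 else 2.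
Proof.
move=> on; have os : odd #|s| = odd t by rewrite odd_card_odd_rows oddM on andbT.
apply/eqP; rewrite eq_le; apply/andP; split; last first.
  by case: leqP => [_|st]; [exact: disc_odd_ge1 | exact: disc_odd_ge2].
case: leqP => [ts|st].
  have [B Bs cB] : exists2 B : {set 'I_m}, B \subset s & #|B| = (#|s| + t)./2.
    by apply: subset_of_card; rewrite leq_half_double; lia.
  have [|||b bE] := @exists_rowsum1 B 1 Bs => //; last exact: (@disc_le _ _ _ A b 1).
  by rewrite cB muln1 even_halfK // oddD os addbb.
(* With too few odd rows to reach the sum [t] by entries equal to 1, the value 2
   is put on enough even rows. *)
have [B Bs cB] : exists2 B : {set 'I_m}, B \subset ~: s & #|B| = (t - #|s|)./2.
  apply: subset_of_card; have := cardsC s; rewrite card_ord.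
  by move: st tm; rewrite leq_half_double; lia.
have cB2 : (#|B|.*2 + #|s| = t)%N.
  rewrite cB even_halfK; first by move: st; lia.
  by rewrite oddB ?os ?addbb // ltnW.
have [|||||b bE] := @exists_rowsum (fun i => (i \in s : nat)%:Z + 2 * (i \in B : nat)%:Z) 1.
- by rewrite big_split /= -mulr_sumr !sum_mem; move: cB2; lia.
- move=> i; have := fintype.subsetP Bs i; rewrite finset.inE.
  by case: (i \in B) (i \in s) => [] [] // /(_ isT).
- by [].
- by move=> i; exists (i \in B : nat)%:Z.
- by exists 0; rewrite on.
apply: (@disc_le _ _ _ A b) => i; rewrite bE; have := fintype.subsetP Bs i; rewrite finset.inE.
by case: (i \in B) (i \in s) => [] [] // /(_ isT).
Qed.
End Disc.

(** * Numerical consequences of the bound on n *)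

Lemma ln_ge_half (R : realType) (n : nat) : (2 <= n)%N -> 1 / 2 <= ln (n%:R : R).
Proof.
move=> n2; have N2 : (2 : R) <= n%:R by rewrite ler_nat.
have e1 := expR_ge1Dx (- (1 / 2) : R).
rewrite expRN in e1.
rewrite -(expRK (1 / 2 : R)) ler_ln ?posrE ?expR_gt0 //; last lra.
have e0 := expR_gt0 (1 / 2 : R).
apply: le_trans N2; rewrite -[leLHS]invrK -[leRHS]invrK lef_pV2 ?posrE ?invr_gt0 //; lra.
Qed.

(** With [r = n / m^3] and [L = ln m], the hypothesis says that sqrt r is at
    least a large multiple of [L], while ln n = ln r + 3 L is at most
    2 sqrt r + 3 L. *)
Lemma ln_bound (R : realType) (m n : nat) : (2 <= m)%N ->
  (16 * 4096) ^+ 2 * m%:R ^+ 3 * ln (m%:R : R) ^+ 2 <= n%:R ->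
  4096 * m%:R ^+ 3 * ln (n%:R : R) <= n%:R /\ (3 <= n)%N.
Proof.
move=> m2; have M2 : (2 : R) <= m%:R by rewrite ler_nat.
have := ln_ge_half R m2; set L := ln _ => L2.
have D1 : (1 : R) <= 4096 by lra.
move: (4096 : R) D1 => D D1 nbig.
have m3 : (8 : R) <= m%:R ^+ 3.
  by rewrite (_ : 8 = 2 ^+ 3) ?lerXn2r ?nnegrE //; ring.
have DL : 8 <= 16 * D * L by nra.
have e : (16 * D) ^+ 2 * m%:R ^+ 3 * L ^+ 2 = m%:R ^+ 3 * (16 * D * L) ^+ 2 by ring.
rewrite e in nbig.
have N3 : (3 : R) <= n%:R.
  by apply: le_trans nbig; set X := 16 * D * L in DL *; nra.
have n3 : (3 <= n)%N by rewrite -(ler_nat R).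
split => //.
pose r : R := n%:R / m%:R ^+ 3; pose q := Num.sqrt r.
have mp : 0 < (m%:R : R) ^+ 3 by lra.
have rn : m%:R ^+ 3 * r = n%:R by rewrite /r mulrC divfK ?gt_eqF.
have r0 : 0 < r by rewrite divr_gt0 //; lra.
have qq : q ^+ 2 = r by rewrite sqr_sqrtr ?ltW.
have q0 : 0 < q by rewrite sqrtr_gt0.
have qk : 16 * D * L <= q.
  rewrite -(@ler_pXn2r _ 2) ?nnegrE ?(ltW q0) //; last by lra.
  by rewrite qq -(ler_pM2l mp) rn.
have lnN : ln (n%:R : R) <= 2 * q + 3 * L.
  rewrite -rn lnM ?posrE // lnXn; last lra.
  by rewrite -qq lnXn // -/L; have := ln_sublinear q0; lra.
apply: (@le_trans _ _ (D * m%:R ^+ 3 * (2 * q + 3 * L))).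
  by rewrite ler_pM2l // mulr_gt0 //; lra.
rewrite -rn -qq (mulrC D) -mulrA ler_pM2l //.
have : 0 <= q * (q - 8 * D) by rewrite mulr_ge0 //; nra.
by nra.
Qed.

Lemma exp_bound (R : realType) (m n : nat) : (2 <= m)%N -> (3 <= n)%N ->
  4096 * m%:R ^+ 3 * ln (n%:R : R) <= n%:R ->
  2 ^+ m * expR (- (n%:R / m%:R)) <= (n%:R : R)^-1.
Proof.
move=> m2 n3 nbig; have M2 : (2 : R) <= m%:R by rewrite ler_nat.
have N0 : (0 : R) < n%:R by rewrite ltr0n; lia.
have L2 := ln_ge_half R (ltnW n3).
have e1 : (2 : R) <= expR 1 by apply: le_trans (expR_ge1Dx 1); lra.
apply: (@le_trans _ _ (expR m%:R * expR (- (n%:R / m%:R)))).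
  rewrite ler_wpM2r ?expR_ge0 // -(mulr1 m%:R) expRM_natl lerXn2r ?nnegrE ?expR_ge0 //.
rewrite -expRD -[X in _ <= X^-1](lnK (x := n%:R)) ?posrE // -expRN ler_expR.
set L := ln _ in nbig L2 *.
have h : m%:R + L <= n%:R / m%:R.
  rewrite ler_pdivlMr; last lra.
  apply: le_trans nbig; have : 4 * m%:R <= (m%:R : R) ^+ 3 by nra.
  nra.
lra.
Qed.

Lemma inv_le_delta (R : realType) (m n : nat) : (2 <= m)%N -> (3 <= n)%N ->
  (n%:R : R)^-1 <= Num.sqrt (m%:R / n%:R * ln n%:R).
Proof.
move=> m2 n3; have M2 : (2 : R) <= m%:R by rewrite ler_nat.
have N3 : (3 : R) <= n%:R by rewrite ler_nat.
have L2 := ln_ge_half R (ltnW n3).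
have N0 : (0 : R) < n%:R by lra.
rewrite -[leLHS]ger0_norm ?invr_ge0 // -sqrtr_sqr ler_sqrt; last first.
  by rewrite mulr_ge0 ?divr_ge0 //; lra.
rewrite expr2 [m%:R / n%:R]mulrC -mulrA ler_pM2l ?invr_gt0 //.
apply: (@le_trans _ _ 1); [rewrite invf_le1 //; lra | nra].
Qed.

(** * The law of the discrepancy *)

Lemma sum_weight_odd_rows_pred (R : realType) (m n t : nat) (F : pred {set 'I_m}) :
  (0 < t)%N -> (t < m)%N ->
  `|\sum_(A : 'M[bool]_(m, n) | F (odd_rows A)) weight R t A
    - 2 ^- m * \sum_(s | F s) (1 + (-1) ^+ (#|s| + t * n))|
  <= 2 ^+ m * expR (- (n%:R / m%:R)).
Proof.
move=> t0 tm; rewrite (partition_big (@odd_rows m n) F) //= mulr_sumr -sumrB.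
apply: le_trans (ler_norm_sum _ _ _) _.
apply: (@le_trans _ _ (\sum_(s : {set 'I_m}) expR (- (n%:R / m%:R)) : R)); last first.
  by rewrite sumr_const -cardsT -powersetT card_powerset cardsT card_ord -[leLHS]mulr_natl natrX.
rewrite big_mkcond; apply: ler_sum => s _; case: ifP => Fs; last exact: expR_ge0.
apply: le_trans (sum_weight_odd_rows R n s t0 tm); rewrite le_eqVlt; apply/orP; left.
apply/eqP; congr `|_ - _|; apply: eq_bigl => A.
by case: eqP => [->|]; rewrite ?Fs ?andbT ?andbF.
Qed.

Lemma sum_sets_by_card (R : realType) (m : nat) (F : pred nat) (f : nat -> R) :
  \sum_(s : {set 'I_m} | F #|s|) f #|s| = \sum_(0 <= k < m.+1 | F k) f k * ('C(m, k))%:R.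
Proof.
rewrite big_mkord (partition_big (fun s : {set 'I_m} => inord #|s| : 'I_m.+1) (fun k => F k)) /=.
  apply: eq_bigr => k Fk; rewrite -[m in 'C(m, _)]card_ord -card_draws mulr_natr -sumr_const.
  apply: eq_big => [s|s /andP[_ /eqP <-]]; last first.
    by rewrite inordK // ltnS -[X in (_ <= X)%N](card_ord m) max_card.
  rewrite finset.inE -val_eqE /= inordK ?ltnS -?[X in (_ <= X)%N](card_ord m) ?max_card //.
  by case: eqP => [->|]; rewrite ?Fk ?andbT ?andbF.
by move=> s Fs; rewrite inordK // ltnS -[X in (_ <= X)%N](card_ord m) max_card.
Qed.

(** The size of a uniformly random subset is binomial, and the factor
    1 + (-1)^(k + t n) is twice the indicator of [k = t] modulo 2. *)
Lemma condPr_binomial_sets (R : realType) (m n t : nat) (F : pred nat) : (0 < m)%N -> odd n ->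
  condPr (binomial_prob m (2^-1 : R)) [set k | F k] [set k | k = t %[mod 2]] =
  2 ^- m * \sum_(s : {set 'I_m} | F #|s|) (1 + (-1) ^+ (#|s| + t * n)).
Proof.
move=> m0 on; rewrite (sum_sets_by_card m F (fun k => 1 + (-1) ^+ (k + t * n))) /condPr.
have -> : [set k | k = t %[mod 2]] = [set k | k == t %[mod 2]].
  by apply/seteqP; split=> k /= /eqP.
have -> : [set k | F k] `&` [set k | k == t %[mod 2]] = [set k | (k == t %[mod 2]) && F k].
  by apply/seteqP; split=> k /=; [case=> -> -> | case/andP].
rewrite !Pr_binomial_half (sum_binomial_parity _ t m0) -mulf_div.
have two : (2 : R) != 0 by rewrite pnatr_eq0.
rewrite divff ?mul1r ?invr_eq0 ?expf_neq0 //.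
have -> : (2 : R) ^- m = 2^-1 * 2 ^- m.-1 by rewrite -invfM -exprS prednK.
rewrite mulrC mulrAC mulrC; congr (_ * _).
rewrite mulr_sumr big_mkcond [RHS]big_mkcond; apply: eq_bigr => k _.
rewrite -signr_odd oddD oddM on andbT !modn2.
by case: (F k) (odd k) (odd t) => [] [] [] //=; rewrite ?expr0 ?expr1; field.
Qed.

Lemma le_sum_weight (R : realType) (m n t : nat) (E E' : pred 'M[bool]_(m, n)) :
  (forall A, (forall j, col j A \in sparse_vectors m t) -> far_sum R t A < 1 -> E A = E' A) ->
  `|\sum_(A | E A) weight R t A - \sum_(A | E' A) weight R t A|
  <= \sum_(A : 'M[bool]_(m, n) | 1 <= far_sum R t A) weight R t A.
Proof.
move=> EE'; rewrite big_mkcond [X in _ - X]big_mkcond [leRHS]big_mkcond -sumrB /=.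
apply: le_trans (ler_norm_sum _ _ _) _; apply: ler_sum => A _.
have w0 := weight_ge0 R t A.
have [wA|/weight_neq0 sA] := eqVneq (weight R t A) 0.
  by rewrite wA !if_same subrr normr0.
have [_|good] := leP 1 (far_sum R t A); last by rewrite (EE' A sA good) subrr normr0.
by do 2!case: ifP => _; rewrite ?subrr ?subr0 ?sub0r ?normrN ?normr0 ?ger0_norm.
Qed.

Lemma Pr_discE (R : realType) (d : measure_display) (T : measurableType d)
    (P : probability T R) (m n t k : nat) (M : T -> 'M[bool]_(m, n)) :
  random_sparse P t M ->
  Pr_disc P M k = \sum_(A : 'M[bool]_(m, n) | disc (real_mx R A) == k%:R) weight R t A.
Proof.
move=> rM; rewrite -(Pr_random_sparse (fun A => disc (real_mx R A) == k%:R) rM) /Pr_disc.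
by congr Pr; apply/seteqP; split => w /= /eqP.
Qed.

(** The two errors are the probability that [far_sum] is at least 1, and the
    distance of the law of [odd_rows] from its limit. *)
Lemma Pr_disc_near (R : realType) (d : measure_display) (T : measurableType d)
    (P : probability T R) (m n t k : nat) (M : T -> 'M[bool]_(m, n)) (F : pred {set 'I_m}) :
  (0 < t)%N -> (t < m)%N -> (3 <= n)%N ->
  4096 * m%:R ^+ 3 * ln (n%:R : R) <= n%:R ->
  random_sparse P t M ->
  (forall A : 'M[bool]_(m, n), (forall j, col j A \in sparse_vectors m t) ->
     far_sum R t A < 1 -> (disc (real_mx R A) == k%:R) = F (odd_rows A)) ->
  `|Pr_disc P M k - 2 ^- m * \sum_(s | F s) (1 + (-1) ^+ (#|s| + t * n))|
  <= 2 * Num.sqrt (m%:R / n%:R * ln n%:R).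
Proof.
move=> t0 tm n3 nbig rM dF; have m2 : (2 <= m)%N by apply: leq_trans tm.
rewrite (Pr_discE k rM).
have h1 := le_trans (le_sum_weight dF) (sum_weight_bad t0 tm (ltnW (ltnW n3)) nbig).
have h2 := le_trans (sum_weight_odd_rows_pred R n F t0 tm) (exp_bound m2 n3 nbig).
apply: le_trans (ler_distD (\sum_(A : 'M[bool]_(m, n) | F (odd_rows A)) weight R t A) _ _) _.
have := inv_le_delta R m2 n3; lra.
Qed.

Theorem theorem3p3 (R : realType) :
exists c C : R, [/\ 0 < c, 0 < C &
    forall (m t n : nat), (0 < t)%N -> (t < m)%N ->
      c * m%:R ^+ 3 * ln m%:R ^+ 2 <= n%:R ->
    forall (d : measure_display) (T : measurableType d) (P : probability T R)
      (M : T -> 'M[bool]_(m, n)), random_sparse P t M ->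
    let delta : R := Num.sqrt (m%:R / n%:R * ln n%:R) in
    let Y : set nat -> \bar R := binomial_prob m (2^-1) in
    (~~ odd n ->
       `|Pr_disc P M 0 - 2 ^- m.-1| <= C * delta /\
       `|Pr_disc P M 1 - (1 - 2 ^- m.-1)| <= C * delta) /\
    (odd n ->
       [/\ Pr_disc P M 0 = 0,
           `|Pr_disc P M 1
             - condPr Y [set k | (t <= k)%N] [set k | k = t %[mod 2]]|
             <= C * delta &
           `|Pr_disc P M 2
             - condPr Y [set k | (k < t)%N] [set k | k = t %[mod 2]]|
             <= C * delta])].
Proof.
have c0 : (0 : R) < 16 * 4096 by lra.
exists ((16 * 4096) ^+ 2), 2; split; [exact: exprn_gt0 c0 | lra | ].
move=> m t n t0 tm nbig d T P M rM delta Y.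
have m2 : (2 <= m)%N by apply: leq_trans tm.
have m0 : (0 < m)%N by apply: ltnW.
have [nbig' n3] := ln_bound m2 nbig.
have near := Pr_disc_near t0 tm n3 nbig' rM.
have two : (2 : R) != 0 by rewrite pnatr_eq0.
have half : 2 ^- m * 2 = 2 ^- m.-1 :> R.
  by rewrite -[in LHS](prednK m0) exprS invfM mulrAC mulVf ?mul1r.
split=> [en|on].
  have sg (s : {set 'I_m}) : (-1) ^+ (#|s| + t * n) = (-1) ^+ #|s| :> R.
    by rewrite -signr_odd oddD oddM (negPf en) andbF addbF signr_odd.
  have S0 : 2 ^- m * \sum_(s : {set 'I_m} | s == finset.set0) (1 + (-1) ^+ (#|s| + t * n))
      = 2 ^- m.-1 :> R.
    by rewrite big_pred1_eq sg cards0 expr0.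
  (* The limit law has total mass 1, whence the probability of a nonempty set. *)
  have ST : 2 ^- m * \sum_(s : {set 'I_m}) (1 + (-1) ^+ (#|s| + t * n)) = 1 :> R.
    have z : \sum_(s : {set 'I_m}) (-1) ^+ #|s| = 0 :> R.
      transitivity (\sum_(s : {set 'I_m}) \prod_i (if i \in s then -1 else 1 : R)).
        by apply: eq_bigr => s _; rewrite -big_mkcond prodr_const.
      rewrite -(bigA_distr 1 +%R) (eq_bigr (fun=> 0)) => [|i _]; last by rewrite /= addNr.
      by rewrite prodr_const card_ord expr0n (gtn_eqF m0).
    rewrite (eq_bigr _ (fun s _ => congr1 (+%R 1) (sg s))) big_split /= z addr0.
    rewrite sumr_const -cardsT -powersetT card_powerset cardsT card_ord natrX.
    by rewrite mulVf // expf_neq0.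
  split.
    rewrite -S0; apply: near => A sA good.
    by rewrite (disc_even t0 tm n3 sA good en) pnatr_eq0 eqb0 negbK.
  have -> : 1 - 2 ^- m.-1 = 2 ^- m * \sum_(s : {set 'I_m} | s != finset.set0)
      (1 + (-1) ^+ (#|s| + t * n)) :> R.
    by rewrite -S0 -[X in X - _]ST (bigID (fun s : {set 'I_m} => s == finset.set0)) /=; ring.
  apply: near => A sA good.
  by rewrite (disc_even t0 tm n3 sA good en) eqr_nat eqb1.
split.
- rewrite (Pr_discE 0 rM) big1 // => A /eqP dA.
  apply/eqP/negPn/negP => /weight_neq0 sA.
  have : 1 <= disc (real_mx R A) by exact: (disc_odd_ge1 R t0 tm n3 sA on).
  by rewrite dA ler10.
- rewrite (condPr_binomial_sets R t (fun k => (t <= k)%N) m0 on).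
  apply: near => A sA good; rewrite (disc_odd t0 tm n3 sA good on).
  by case: ifP => _; [exact: (eqr_nat R 1 1) | exact: (eqr_nat R 2 1)].
- rewrite (condPr_binomial_sets R t (fun k => (k < t)%N) m0 on).
  apply: near => A sA good; rewrite (disc_odd t0 tm n3 sA good on) ltnNge.
  by case: ifP => _; [exact: (eqr_nat R 1 2) | exact: (eqr_nat R 2 2)].
Qed.
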